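(* Let $\mathcal{K}$ be a cartesian closed $\infty$-cosmos, let $k\colon A\to B$ be an initial functor, and let $f\colon B\to C$ be any diagram (functor). Then a limit of $f$ also defines a limit of $fk\colon A\to C$. Conversely, if a limit of $fk\colon A\to C$ exists then so does a limit of $f$, and it is given by the same point $\ell\colon 1\to C$.
   Context: An $\infty$-cosmos (with all objects cofibrant) is a simplicially enriched category $\mathcal{K}$ whose mapping spaces $\mathrm{map}(A,B)$ are quasi-categories, equipped with a subcategory of isofibrations (written $\twoheadrightarrow$), such that: (a) $\mathcal{K}$ has, in the simplicially enriched sense, a terminal object $1$, cotensors $U\pitchfork A$ of every object $A$ by every finitely presented simplicial set $U$, and pullbacks of isofibrations along arbitrary morphisms (''simplicial pullbacks''); (b) isofibrations include all isomorphisms and all maps $A\to 1$, are stable under pullback, for every isofibration $p\colon E\twoheadrightarrow B$ and inclusion $U\hookrightarrow V$ of finitely presented simplicial sets the induced map $V\pitchfork E\to (U\pitchfork E)\times_{U\pitchfork B}(V\pitchfork B)$ is an isofibration, and $\mathrm{map}(X,p)$ is an isofibration of quasi-categories for every object $X$; (c) every object has the left lifting property with respect to trivial fibrations. Here $f$ is an equivalence if $\mathrm{map}(X,f)$ is an equivalence of quasi-categories for all $X$, and a trivial fibration if it is an isofibration and an equivalence. Objects of $\mathcal{K}$ are called $\infty$-categories and its morphisms functors. The homotopy 2-category $\mathcal{K}_2$ has the same objects and 1-cells, with $\hom(A,B)$ the homotopy category of $\mathrm{map}(A,B)$. For an object $B$, the sliced $\infty$-cosmos $\mathcal{K}/B$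 has as objects the isofibrations with codomain $B$, and as mapping quasi-category from $p\colon E\to B$ to $q\colon F\twoheadrightarrow B$ the fibre of $\mathrm{map}(E,q)\colon\mathrm{map}(E,F)\to\mathrm{map}(E,B)$ over $p$; its isofibrations and equivalences are created by the forgetful functor. Its homotopy 2-category is $(\mathcal{K}/B)_2$. $\mathcal{K}$ is cartesian closed if the binary product extends to a simplicially enriched two-variable adjunction $\mathrm{map}(A\times B,C)\cong\mathrm{map}(A,C^B)\cong\mathrm{map}(B,C^A)$. Limits. In a 2-category, a 2-cell $\nu\colon ur\Rightarrow f$ with $u\colon P\to Q$, $f\colon K\to Q$, $r\colon K\to P$ is an absolute right lifting diagram if for every $X$, all $p\colon X\to K$, $q\colon X\to P$, and every 2-cell $\chi\colon uq\Rightarrow fp$ there is a unique $\zeta\colon q\Rightarrow rp$ with $\chi=\nu p\cdot u\zeta$. A limit of a functor $f\colon B\to C$ is a point $\ell\colon 1\to C$ with a 2-cell $\nu\colon C^{!}\ell\Rightarrow f$ that is an absolute right lifting diagram in $\mathcal{K}_2$, where $f$ is transposed to $1\to C^B$ and $C^{!}\colon C\to C^B$ is the constant diagram functor; transposing, $\nu$ is a limit cone $\ell\,!\Rightarrow f\colon B\to C$. In the first assertion, the limit cone for $fk$ is the restriction $\nu k$. Commas. For functors $f\colon B\to A$, $g\colon C\to A$, the comma $\infty$-category $f\downarrow g$ is the simplicial pullback of $(p_1,p_0)\colon\Delta^1\pitchfork A\twoheadrightarrow A\times A$ (evaluation at $1$ and $0$) along $g\times f\colon C\times B\to A\times A$;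 it carries an isofibration $(p_1,p_0)\colon f\downarrow g\twoheadrightarrow C\times B$ and a canonical 2-cell $\phi\colon fp_0\Rightarrow gp_1$. Write $A\downarrow g$ or $f\downarrow A$ when the other functor is $\mathrm{id}_A$. Every 2-cell $\alpha\colon fb\Rightarrow gc$ (with $b\colon X\to B$, $c\colon X\to C$) equals $\phi a$ for a functor $a\colon X\to f\downarrow g$ with $p_1a=c$, $p_0a=b$, unique up to isomorphism over $C\times B$ (''induced by $\alpha$''). Modules. A 2-cell $\chi\colon e'\Rightarrow e\colon X\to E$ in a homotopy 2-category is $p$-cartesian for an isofibration $p\colon E\twoheadrightarrow B$ if (i) for all $\tau\colon e''\Rightarrow e$ and $\gamma\colon pe''\Rightarrow pe'$ with $p\tau=p\chi\cdot\gamma$ there is $\bar\gamma\colon e''\Rightarrow e'$ with $p\bar\gamma=\gamma$ and $\tau=\chi\cdot\bar\gamma$; and (ii) any $\gamma\colon e'\Rightarrow e'$ with $\chi\cdot\gamma=\chi$ and $p\gamma$ an identity is an isomorphism. The isofibration $p$ is a cartesian fibration if every 2-cell $\alpha\colon b\Rightarrow pe$ has a $p$-cartesian lift $\chi\colon e'\Rightarrow e$ with $p\chi=\alpha$, and $p$-cartesian 2-cells are closed under precomposition by functors. Cocartesian fibrations are defined dually, reversing 2-cells. An object is groupoidal if every 2-cell with that object as codomain in the homotopy 2-category is invertible. A module $E\colon A\nrightarrow B$ is an isofibration $(q,p)\colon E\twoheadrightarrow A\times B$ that is a cartesian fibration in $(\mathcal{K}/A)_2$, a cocartesian fibration in $(\mathcal{K}/B)_2$,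 and groupoidal as an object of $\mathcal{K}/(A\times B)$. Every comma $f\downarrow g$ is a module $C\nrightarrow B$. The virtual double category $\mathrm{Mod}_{\mathcal{K}}$ has $\infty$-categories as objects, functors as vertical arrows, modules as horizontal arrows, and as cells with horizontal source a composable sequence $E_i\colon A_{i-1}\nrightarrow A_i$ ($1\le i\le n$), horizontal target $F\colon B_0\nrightarrow B_n$, and vertical boundaries $f\colon A_0\to B_0$, $g\colon A_n\to B_n$, the isomorphism classes of functors $E_1\times_{A_1}\cdots\times_{A_{n-1}}E_n\to F$ lying over $f\times g$, isomorphism being taken in the fibre of $\mathrm{map}(E_1\times_{A_1}\cdots\times_{A_{n-1}} E_n,F)\to\mathrm{map}(E_1\times_{A_1}\cdots\times_{A_{n-1}} E_n,B_0\times B_n)$ (for $n=0$ the source is the identity span). A cell $\nu\colon E_1\times\cdots\times E_n\Rightarrow E$ with identity vertical boundaries is a composite if every cell with source $F_1,\dots,F_l,E_1,\dots,E_n,G_1,\dots,G_m$ factors uniquely through $(\mathrm{id}_{F_1},\dots,\mathrm{id}_{F_l},\nu,\mathrm{id}_{G_1},\dots,\mathrm{id}_{G_m})$. Exact squares. A 2-cell $\lambda\colon fh\Rightarrow gk$ with $h\colon D\to B$, $k\colon D\to C$, $f\colon B\to A$, $g\colon C\to A$ is exact if the cell $\hat\lambda\colon (k\downarrow C)\times(B\downarrow h)\Rightarrow f\downarrow g$ is a composite, where $\hat\lambda$ is represented by the functor $(k\downarrow C)\times_D(B\downarrow h)\to f\downarrow g$ over $C\times B$ induced by the pasting of $f$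 applied to the canonical 2-cell of $B\downarrow h$, then $\lambda$, then $g$ applied to the canonical 2-cell of $k\downarrow C$. Initial functors. $k\colon A\to B$ is initial if the identity 2-cell $\mathrm{id}_1\circ\,!_A=\,!_B\circ k$, regarded as a square with $h=\,!_A\colon A\to 1$, $k\colon A\to B$, $f=\mathrm{id}_1\colon 1\to 1$, $g=\,!_B\colon B\to 1$ in the preceding definition, is exact. *)

(* Defs.v *)
From mathcomp Require Import all_boot.
From Stdlib Require Import ProofIrrelevance.

Set Implicit Arguments.
Unset Strict Implicit.
Unset Printing Implicit Defensive.

(** * Simplicial sets *)

(** [dmor m n] is the set of order-preserving maps [m] -> [n], where
    [m] = {0 < ... < m} is ['I_m.+1]. *)
Definition monotone m n (f : {ffun 'I_m.+1 -> 'I_n.+1}) : bool :=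
  [forall i : 'I_m.+1, forall j : 'I_m.+1, (i <= j) ==> (f i <= f j)].

Definition dmor m n := {f : {ffun 'I_m.+1 -> 'I_n.+1} | monotone f}.

Definition dfun m n (t : dmor m n) : 'I_m.+1 -> 'I_n.+1 := sval t.

Fact dmor_mono m n (t : dmor m n) (i j : 'I_m.+1) :
  i <= j -> dfun t i <= dfun t j.
Proof. by move: (valP t) => /forallP/(_ i)/forallP/(_ j)/implyP. Qed.

Fact mkd_subproof m n (f : 'I_m.+1 -> 'I_n.+1) :
  (forall i j : 'I_m.+1, i <= j -> f i <= f j) -> monotone (finfun f).
Proof.
move=> H; apply/forallP=> i; apply/forallP=> j; apply/implyP=> ij.
by rewrite !ffunE H.
Qed.

Definition mkd m n (f : 'I_m.+1 -> 'I_n.+1)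
  (H : forall i j : 'I_m.+1, i <= j -> f i <= f j) : dmor m n :=
  exist _ (finfun f) (mkd_subproof H).

Fact dmorP m n (s t : dmor m n) : dfun s =1 dfun t -> s = t.
Proof. by move=> H; apply/val_inj/ffunP. Qed.

Definition did n : dmor n n := @mkd n n id (fun i j H => H).

Definition dcomp m n p (t : dmor n p) (s : dmor m n) : dmor m p :=
  mkd (fun i j H => dmor_mono t (dmor_mono s H)).

Definition dconst m n (k : 'I_n.+1) : dmor m n :=
  @mkd m n (fun=> k) (fun _ _ _ => leqnn k).
Arguments dconst : clear implicits.

Fact dface_subproof n (k : 'I_n.+2) (i j : 'I_n.+1) :
  i <= j -> lift k i <= lift k j.
Proof. by rewrite /= leq_bump2. Qed.

(** The coface map that omits [k]. *)
Definition dface n (k : 'I_n.+2) : dmor n n.+1 := mkd (@dface_subproof n k).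

Fact dcompE m n p (t : dmor n p) (s : dmor m n) i :
  dfun (dcomp t s) i = dfun t (dfun s i).
Proof. by rewrite /dfun /= ffunE. Qed.
Fact didE n i : dfun (did n) i = i.
Proof. by rewrite /dfun /= ffunE. Qed.
Fact dconstE m n k i : dfun (dconst m n k) i = k.
Proof. by rewrite /dfun /= ffunE. Qed.

Record sset := SSet {
  simp :> nat -> Type;
  act : forall m n, dmor m n -> simp n -> simp m;
  act_id : forall n (x : simp n), act (did n) x = x;
  act_comp : forall m n p (t : dmor n p) (s : dmor m n) (x : simp p),
    act (dcomp t s) x = act s (act t x) }.

Record smap (X Y : sset) := SMap {
  sfun :> forall n, X n -> Y n;
  sfun_act : forall m n (t : dmor m n) (x : X n),
    sfun (act t x) = act t (sfun x) }.

Definition smap_comp (X Y Z : sset) (g : smap Y Z) (f : smap X Y) : smap X Z.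
Proof.
exists (fun n x => g n (f n x)).
abstract by move=> m n t x; rewrite !sfun_act.
Defined.

Definition smono (X Y : sset) (f : smap X Y) : Prop :=
  forall n (x y : X n), f n x = f n y -> x = y.

(** The degenerate [n]-simplex on a vertex. *)
Definition deg (X : sset) n (x : X 0) : X n := act (dconst n 0 ord0) x.

Definition sprod (X Y : sset) : sset.
Proof.
exists (fun n => (X n * Y n)%type) (fun m n t z => (act t z.1, act t z.2)).
- abstract by move=> n [x y] /=; rewrite !act_id.
- abstract by move=> m n p t s [x y] /=; rewrite !act_comp.
Defined.

Definition sfst (X Y : sset) : smap (sprod X Y) X :=
  @SMap (sprod X Y) X (fun n z => z.1) (fun m n t z => erefl).

(** The standard simplex. *)
Definition Delta (n : nat) : sset.
Proof.
exists (fun m => dmor m n) (fun p m s t => dcomp t s).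
- abstract by move=> m t; apply: dmorP => i; rewrite dcompE didE.
- abstract by move=> m p q t s x; apply: dmorP => i; rewrite !dcompE.
Defined.

(** The horn consists of the simplices of [Delta n] whose image omits some
    vertex other than [k]. *)
Definition in_horn n (k : 'I_n.+1) m (t : dmor m n) : bool :=
  [exists j, (j != k) && [forall i, dfun t i != j]].

Fact in_horn_act n (k : 'I_n.+1) m p (s : dmor p m) (t : dmor m n) :
  in_horn k t -> in_horn k (dcomp t s).
Proof.
case/existsP=> j /andP[jk /forallP H]; apply/existsP; exists j.
by rewrite jk; apply/forallP=> i; rewrite dcompE.
Qed.

Definition horn n (k : 'I_n.+1) : sset.
Proof.
exists (fun m => {t : dmor m n | in_horn k t})
  (fun p m s t => exist _ (dcomp (sval t) s) (in_horn_act s (valP t))).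
- abstract by move=> m t; apply: val_inj; apply: dmorP => i /=;
    rewrite dcompE didE.
- abstract by move=> m p q t s x; apply: val_inj; apply: dmorP => i /=;
    rewrite !dcompE.
Defined.

Definition horn_incl n (k : 'I_n.+1) : smap (horn k) (Delta n) :=
  @SMap (horn k) (Delta n) (fun m t => sval t) (fun m n t x => erefl).

(** The nerve of the free-living isomorphism. *)
Definition Iso : sset.
Proof.
exists (fun n => {ffun 'I_n.+1 -> bool})
  (fun m n t x => [ffun i => x (dfun t i)]).
- abstract by move=> n x; apply/ffunP=> i; rewrite ffunE didE.
- abstract by move=> m n p t s x; apply/ffunP=> i; rewrite !ffunE dcompE.
Defined.

Definition iso_pt (b : bool) n : Iso n := [ffun=> b].

Definition iso_incl : smap (Delta 0) Iso.
Proof.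
exists (fun n _ => iso_pt false n).
abstract by move=> m n t x; apply/ffunP=> i; rewrite !ffunE.
Defined.

Definition has_rlp (U V E B : sset) (i : smap U V) (p : smap E B) : Prop :=
  forall (u : smap U E) (v : smap V B),
    (forall n x, p n (u n x) = v n (i n x)) ->
    exists w : smap V E,
      (forall n x, w n (i n x) = u n x) /\ (forall n y, p n (w n y) = v n y).

Definition is_qcat (X : sset) : Prop :=
  forall n (k : 'I_n.+1), 0 < k < n -> forall u : smap (horn k) X,
    exists w : smap (Delta n) X, forall m x, w m (horn_incl k m x) = u m x.

Definition qcat_isofib (E B : sset) (p : smap E B) : Prop :=
  (forall n (k : 'I_n.+1), 0 < k < n -> has_rlp (horn_incl k) p) /\
  has_rlp iso_incl p.

Definition qcat_equiv (X Y : sset) (f : smap X Y) : Prop :=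
  exists (g : smap Y X) (a : smap (sprod X Iso) X) (b : smap (sprod Y Iso) Y),
    [/\ forall n x, a n (x, iso_pt false n) = x,
        forall n x, a n (x, iso_pt true n) = g n (f n x),
        forall n y, b n (y, iso_pt false n) = f n (g n y)
      & forall n y, b n (y, iso_pt true n) = y].

Definition nondegenerate (U : sset) n (x : U n) : Prop :=
  forall m (s : dmor n m) (y : U m), x = act s y -> n <= m.

(** For simplicial sets, being finitely presented amounts to having finitely
    many nondegenerate simplices. *)
Definition fin_pres (U : sset) : Prop :=
  exists (T : finType) (e : T -> {n & U n}),
    forall n (x : U n), nondegenerate x -> exists i, e i = existT _ n x.

Fact act_deg (X : sset) m n (t : dmor m n) (x : X 0) :
  act t (deg n x) = deg m x.
Proof.
by rewrite /deg -act_comp; congr act; apply: dmorP => i; rewrite dcompE !dconstE.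
Qed.

Fact deg0 (X : sset) (x : X 0) : deg 0 x = x.
Proof.
rewrite /deg -[RHS]act_id; congr act.
by apply: dmorP => i; rewrite dconstE didE [i]ord1.
Qed.

Section Fibre.
Variables (X Y : sset) (f : smap X Y) (y : Y 0).

Definition fibre_simp n := {x : X n | f n x = deg n y}.

Fact fibre_inj n (a b : fibre_simp n) : sval a = sval b -> a = b.
Proof.
move: a b => [a Ha] [b Hb] /= e; apply: eq_exist_uncurried.
by exists e; apply: proof_irrelevance.
Qed.

Fact fibre_act_subproof m n (t : dmor m n) (x : fibre_simp n) :
  f m (act t (sval x)) = deg m y.
Proof. by rewrite sfun_act (svalP x) act_deg. Qed.

Definition fibre : sset.
Proof.
exists fibre_simp
  (fun m n t x => exist _ (act t (sval x)) (fibre_act_subproof t x)).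
- abstract by move=> n x; apply: fibre_inj; rewrite /= act_id.
- abstract by move=> m n p t s x; apply: fibre_inj; rewrite /= act_comp.
Defined.

End Fibre.

(** * The homotopy category of a quasi-category

    Its objects are the vertices and its arrows are the homotopy classes of
    edges; [h] represents the composite of [f] followed by [g] iff some
    2-simplex has 2nd, 0th and 1st faces [f], [g] and [h].  Arrows are handled
    through representing edges throughout: equality of arrows is [homotopic],
    and composition is the relation [composes f g h], that is [h = g . f]. *)

Section HomotopyCategory.
Variable X : sset.

Definition src (e : X 1) : X 0 := act (dconst 0 1 ord0) e.
Definition tgt (e : X 1) : X 0 := act (dconst 0 1 ord_max) e.

Definition d0 (s : X 2) : X 1 := act (@dface 1 ord0) s.
Definition d1 (s : X 2) : X 1 := act (@dface 1 (lift ord0 ord0)) s.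
Definition d2 (s : X 2) : X 1 := act (@dface 1 ord_max) s.

Definition composes (f g h : X 1) : Prop :=
  exists s : X 2, [/\ d2 s = f, d0 s = g & d1 s = h].

Definition homotopic (f g : X 1) : Prop := composes f (deg 1 (tgt f)) g.

Definition is_iso (f : X 1) : Prop :=
  exists g, composes f g (deg 1 (src f)) /\ composes g f (deg 1 (tgt f)).

Definition isomorphic (x y : X 0) : Prop :=
  exists e, [/\ src e = x, tgt e = y & is_iso e].

End HomotopyCategory.

(** * Simplicially enriched categories *)

Record scat := SCat {
  ob :> Type;
  hom : ob -> ob -> sset;
  scomp : forall A B C n, hom B C n -> hom A B n -> hom A C n;
  idm : forall A, hom A A 0;
  scomp_act : forall A B C m n (t : dmor m n) (g : hom B C n) (f : hom A B n),
    act t (scomp g f) = scomp (act t g) (act t f);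
  scompA : forall A B C D n (h : hom C D n) (g : hom B C n) (f : hom A B n),
    scomp h (scomp g f) = scomp (scomp h g) f;
  scomp_idl : forall A B n (f : hom A B n), scomp (deg n (idm B)) f = f;
  scomp_idr : forall A B n (f : hom A B n), scomp f (deg n (idm A)) = f }.

Arguments hom {s}.
Arguments idm {s}.

Declare Scope cosmos_scope.
Delimit Scope cosmos_scope with cosmos.
Local Open Scope cosmos_scope.

Notation "g ∘ f" := (scomp g f)
  (at level 40, left associativity) : cosmos_scope.

(** Whiskering of an [n]-simplex by a functor. *)
Notation "u *> x" := (scomp (deg _ u) x)
  (at level 40, left associativity) : cosmos_scope.
Notation "x <* v" := (scomp x (deg _ v))
  (at level 40, left associativity) : cosmos_scope.

Section SimplicialCategory.
Variable K : scat.
Implicit Types (A B C D E P Q X Y : K).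

Fact deg_comp A B C n (g : hom B C 0) (f : hom A B 0) :
  deg n (g ∘ f) = deg n g ∘ deg n f.
Proof. by rewrite /deg scomp_act. Qed.

Fact scomp_id0l A B (f : hom A B 0) : idm B ∘ f = f.
Proof. by rewrite -[idm B]deg0 scomp_idl. Qed.

Fact scomp_id0r A B (f : hom A B 0) : f ∘ idm A = f.
Proof. by rewrite -[idm A]deg0 scomp_idr. Qed.

Definition postc X A B (f : hom A B 0) : smap (hom X A) (hom X B).
Proof.
exists (fun n x => f *> x).
abstract by move=> m n t x; rewrite scomp_act act_deg.
Defined.

Definition cat_iso A B (f : hom A B 0) : Prop :=
  exists g : hom B A 0, g ∘ f = idm A /\ f ∘ g = idm B.

Definition equivalence A B (f : hom A B 0) : Prop :=
  forall X, qcat_equiv (postc X f).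

(** ** Enriched limits *)

Record terminal := Terminal {
  tm_ob : K;
  bang : forall X, hom X tm_ob 0;
  bang_uniq : forall X n (x : hom X tm_ob n), x = deg n (bang X) }.

Record pullback A E B (f : hom A B 0) (p : hom E B 0) := Pullback {
  pb_ob : K;
  pb_fst : hom pb_ob A 0;
  pb_snd : hom pb_ob E 0;
  pb_eq : f ∘ pb_fst = p ∘ pb_snd;
  pb_lift : forall X n (a : hom X A n) (e : hom X E n),
    f *> a = p *> e -> hom X pb_ob n;
  pb_liftl : forall X n (a : hom X A n) (e : hom X E n) (H : f *> a = p *> e),
    pb_fst *> pb_lift H = a;
  pb_liftr : forall X n (a : hom X A n) (e : hom X E n) (H : f *> a = p *> e),
    pb_snd *> pb_lift H = e;
  pb_uniq : forall X n (x y : hom X pb_ob n),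
    pb_fst *> x = pb_fst *> y -> pb_snd *> x = pb_snd *> y -> x = y }.

(** An [n]-simplex of the simplicial set of maps from [U] to [hom X A] is a map
    [sprod U (Delta n) -> hom X A]; [cot_lift], [cot_beta] and [cot_uniq] say
    that composition with the universal cone is an isomorphism onto it from
    [hom X cot_ob]. *)
Record cotensor (U : sset) A := Cotensor {
  cot_ob : K;
  cot_cone : smap U (hom cot_ob A);
  cot_lift : forall X n, smap (sprod U (Delta n)) (hom X A) -> hom X cot_ob n;
  cot_beta : forall X n (c : smap (sprod U (Delta n)) (hom X A)) m (u : U m)
      (t : dmor m n),
    cot_cone m u ∘ act t (cot_lift c) = c m (u, t);
  cot_uniq : forall X n (x y : hom X cot_ob n),
    (forall m (u : U m) (t : dmor m n),
       cot_cone m u ∘ act t x = cot_cone m u ∘ act t y) -> x = y }.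

Definition cot_lift0 U A (P : cotensor U A) X (c : smap U (hom X A)) :
  hom X (cot_ob P) 0 := cot_lift P (smap_comp c (sfst U (Delta 0))).

(** The functors induced on cotensors by [f : A -> B] and by [i : U -> V]. *)
Definition cot_post U A B (P : cotensor U A) (Q : cotensor U B)
  (f : hom A B 0) : hom (cot_ob P) (cot_ob Q) 0 :=
  cot_lift0 Q (smap_comp (postc _ f) (cot_cone P)).

Definition cot_pre U V A (i : smap U V) (P : cotensor V A) (Q : cotensor U A) :
  hom (cot_ob P) (cot_ob Q) 0 :=
  cot_lift0 Q (smap_comp (cot_cone P) i).

(** ** Notions in the homotopy 2-category

    The 2-cells [f => g] of the homotopy 2-category are the arrows of the
    homotopy category of [hom A B], hence are represented by edges. *)

Definition abs_right_lifting P Q D (u : hom P Q 0) (f : hom D Q 0)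
    (r : hom D P 0) (nu : hom D Q 1) : Prop :=
  [/\ src nu = u ∘ r, tgt nu = f &
  forall X (p : hom X D 0) (q : hom X P 0) (chi : hom X Q 1),
    src chi = u ∘ q -> tgt chi = f ∘ p ->
    let lifts (zeta : hom X P 1) :=
      [/\ src zeta = q, tgt zeta = r ∘ p
        & composes (u *> zeta) (nu <* p) chi] in
    exists zeta, lifts zeta /\
      forall zeta', lifts zeta' -> homotopic zeta' zeta].

Section Fibrations.
Variables (E B : K) (p : hom E B 0).

Definition cartesian_cell X (chi : hom X E 1) : Prop :=
  (forall (tau : hom X E 1) (gamma : hom X B 1),
     tgt tau = tgt chi -> src gamma = p ∘ src tau ->
     tgt gamma = p ∘ src chi ->
     composes gamma (p *> chi) (p *> tau) ->
     exists gbar : hom X E 1,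
       [/\ src gbar = src tau, tgt gbar = src chi,
           homotopic (p *> gbar) gamma & composes gbar chi tau]) /\
  (forall gamma : hom X E 1,
     src gamma = src chi -> tgt gamma = src chi ->
     composes gamma chi chi ->
     homotopic (p *> gamma) (deg 1 (p ∘ src chi)) -> is_iso gamma).

Definition cocartesian_cell X (chi : hom X E 1) : Prop :=
  (forall (tau : hom X E 1) (gamma : hom X B 1),
     src tau = src chi -> src gamma = p ∘ tgt chi ->
     tgt gamma = p ∘ tgt tau ->
     composes (p *> chi) gamma (p *> tau) ->
     exists gbar : hom X E 1,
       [/\ src gbar = tgt chi, tgt gbar = tgt tau,
           homotopic (p *> gbar) gamma & composes chi gbar tau]) /\
  (forall gamma : hom X E 1,
     src gamma = tgt chi -> tgt gamma = tgt chi ->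
     composes chi gamma chi ->
     homotopic (p *> gamma) (deg 1 (p ∘ tgt chi)) -> is_iso gamma).

Definition cartesian_fibration : Prop :=
  (forall X (e : hom X E 0) (alpha : hom X B 1), tgt alpha = p ∘ e ->
     exists chi : hom X E 1,
       [/\ tgt chi = e, homotopic (p *> chi) alpha & cartesian_cell chi]) /\
  (forall X Y (chi : hom X E 1) (x : hom Y X 0),
     cartesian_cell chi -> cartesian_cell (chi <* x)).

Definition cocartesian_fibration : Prop :=
  (forall X (e : hom X E 0) (alpha : hom X B 1), src alpha = p ∘ e ->
     exists chi : hom X E 1,
       [/\ src chi = e, homotopic (p *> chi) alpha & cocartesian_cell chi]) /\
  (forall X Y (chi : hom X E 1) (x : hom Y X 0),
     cocartesian_cell chi -> cocartesian_cell (chi <* x)).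

End Fibrations.

Definition groupoidal E : Prop := forall X (chi : hom X E 1), is_iso chi.

End SimplicialCategory.

(** * Infinity-cosmoi *)

(** In [isofib_leibniz] the pullback and the induced functor [l] are given by
    their universal properties. *)
Record cosmos := Cosmos {
  cat :> scat;
  hom_qcat : forall A B : cat, is_qcat (hom A B);
  isofib : forall E B : cat, hom E B 0 -> Prop;
  one : terminal cat;
  cot : forall (U : sset) (A : cat), fin_pres U -> cotensor U A;
  pb : forall (A E B : cat) (f : hom A B 0) (p : hom E B 0),
    isofib p -> pullback f p;
  isofib_iso : forall (A B : cat) (f : hom A B 0), cat_iso f -> isofib f;
  isofib_comp : forall (A B C : cat) (g : hom B C 0) (f : hom A B 0),
    isofib g -> isofib f -> isofib (g ∘ f);
  isofib_bang : forall A : cat, isofib (bang one A);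
  isofib_pb : forall (A E B : cat) (f : hom A B 0) (p : hom E B 0)
      (P : pullback f p),
    isofib p -> isofib (pb_fst P);
  isofib_leibniz : forall (E B : cat) (p : hom E B 0) (U V : sset)
      (fU : fin_pres U) (fV : fin_pres V) (i : smap U V)
      (P : pullback (cot_pre i (cot B fV) (cot B fU))
                    (cot_post (cot E fU) (cot B fU) p))
      (l : hom (cot_ob (cot E fV)) (pb_ob P) 0),
    isofib p -> smono i ->
    pb_fst P ∘ l = cot_post (cot E fV) (cot B fV) p ->
    pb_snd P ∘ l = cot_pre i (cot E fV) (cot E fU) ->
    isofib l;
  isofib_hom : forall (X E B : cat) (p : hom E B 0),
    isofib p -> qcat_isofib (postc X p);
  all_cofibrant : forall (X E B : cat) (p : hom E B 0) (b : hom X B 0),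
    isofib p -> equivalence p -> exists e : hom X E 0, p ∘ e = b }.

Arguments isofib {c E B}.

(** ** Slices *)

Section Slice.
Variables (K : cosmos) (B : K).

Record over := Over {
  ov_ob : K;
  ov_map : hom ov_ob B 0;
  ov_isofib : isofib ov_map }.

Definition over_hom (E F : over) : sset :=
  fibre (postc (ov_ob E) (ov_map F)) (ov_map E).

Fact over_id_subproof (E : over) :
  postc (ov_ob E) (ov_map E) 0 (idm (ov_ob E)) = deg 0 (ov_map E).
Proof. by rewrite /= deg0 scomp_id0r. Qed.

Fact over_comp_subproof (E F G : over) n (g : over_hom F G n)
    (f : over_hom E F n) :
  postc (ov_ob E) (ov_map G) n (sval g ∘ sval f) = deg n (ov_map E).
Proof.
by move: g f => [g Hg] [f Hf]; move: Hg Hf => /= Hg Hf; rewrite scompA Hg.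
Qed.

Definition slice : scat.
Proof.
exists over over_hom
  (fun E F G n g f => exist _ (sval g ∘ sval f) (over_comp_subproof g f))
  (fun E => exist _ (idm (ov_ob E)) (over_id_subproof E)).
- abstract by move=> *; apply: fibre_inj; rewrite /= scomp_act.
- abstract by move=> *; apply: fibre_inj; rewrite /= scompA.
- abstract by move=> *; apply: fibre_inj; rewrite /= scomp_idl.
- abstract by move=> *; apply: fibre_inj; rewrite /= scomp_idr.
Defined.

End Slice.

Section Cosmos.
Variable K : cosmos.
Implicit Types (A B C D E F X : K).

(** ** Products and exponentials *)

Definition pt : K := tm_ob (one K).
Definition to_pt X : hom X pt 0 := bang (one K) X.

Definition prodP A B : pullback (to_pt A) (to_pt B) :=
  pb (to_pt A) (isofib_bang B).
Definition xprod A B : K := pb_ob (prodP A B).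
Definition pr1 A B : hom (xprod A B) A 0 := pb_fst (prodP A B).
Definition pr2 A B : hom (xprod A B) B 0 := pb_snd (prodP A B).

Fact to_pt_eq X n (x y : hom X pt n) : x = y.
Proof. by rewrite [x]bang_uniq [y]bang_uniq. Qed.

Definition xpair A B X n (a : hom X A n) (b : hom X B n) : hom X (xprod A B) n :=
  pb_lift (prodP A B) (to_pt_eq (to_pt A *> a) (to_pt B *> b)).

Definition prod_map A B C D (f : hom A C 0) (g : hom B D 0) :
  hom (xprod A B) (xprod C D) 0 := xpair (f ∘ pr1 A B) (g ∘ pr2 A B).

(** [expo B C] is the exponential of [C] by [B]; as the product is symmetric,
    the adjunctions in one variable give the two-variable adjunction. *)
Record cartesian_closed := CartesianClosed {
  expo : K -> K -> K;
  ev : forall B C, hom (xprod (expo B C) B) C 0;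
  curry : forall B C X n, hom (xprod X B) C n -> hom X (expo B C) n;
  curry_beta : forall B C X n (c : hom (xprod X B) C n),
    ev B C *> xpair (curry c <* pr1 X B) (deg n (pr2 X B)) = c;
  curry_uniq : forall B C X n (x y : hom X (expo B C) n),
    ev B C *> xpair (x <* pr1 X B) (deg n (pr2 X B)) =
    ev B C *> xpair (y <* pr1 X B) (deg n (pr2 X B)) -> x = y }.

(** ** Limits *)

Definition const_diag (cc : cartesian_closed) B C : hom C (expo cc B C) 0 :=
  curry cc (pr1 C B).

(** The transpose [1 -> C^B] of a diagram ([n = 0]) or of a 2-cell between
    diagrams ([n = 1]). *)
Definition transpose (cc : cartesian_closed) B C n (x : hom B C n) :
  hom pt (expo cc B C) n := curry cc (x <* pr2 pt B).

(** [nu] is a cone [l ! => f : B -> C]. *)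
Definition is_limit (cc : cartesian_closed) B C (f : hom B C 0) (l : hom pt C 0)
    (nu : hom B C 1) : Prop :=
  [/\ src nu = l ∘ to_pt B, tgt nu = f &
  abs_right_lifting (const_diag cc B C) (transpose cc f) l (transpose cc nu)].

(** ** Spans *)

Fact pair1 A B X n (a : hom X A n) (b : hom X B n) : pr1 A B *> xpair a b = a.
Proof. exact: pb_liftl. Qed.

Fact pair2 A B X n (a : hom X A n) (b : hom X B n) : pr2 A B *> xpair a b = b.
Proof. exact: pb_liftr. Qed.

Fact prod_ext A B X n (x y : hom X (xprod A B) n) :
  pr1 A B *> x = pr1 A B *> y -> pr2 A B *> x = pr2 A B *> y -> x = y.
Proof. exact: pb_uniq. Qed.

Fact isofib_pr1 A B : isofib (pr1 A B).
Proof. exact: isofib_pb (prodP A B) (isofib_bang B). Qed.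

Definition prod_flip A B : pullback (to_pt B) (to_pt A) :=
  @Pullback K B A pt (to_pt B) (to_pt A) (xprod A B) (pr2 A B) (pr1 A B)
    (to_pt_eq _ _)
    (fun X n b a _ => xpair a b)
    (fun X n b a _ => pair2 a b)
    (fun X n b a _ => pair1 a b)
    (fun X n x y H2 H1 => prod_ext H1 H2).

Fact isofib_pr2 A B : isofib (pr2 A B).
Proof. exact: isofib_pb (prod_flip A B) (isofib_bang A). Qed.

(** A span [A <- X -> B] whose legs jointly form an isofibration
    [X ->> A x B]; modules are such spans. *)
Record hspan A B := HSpan {
  h_ob : K;
  h_leg : hom h_ob (xprod A B) 0;
  h_isofib : isofib h_leg }.

Definition h_l A B (E : hspan A B) : hom (h_ob E) A 0 := pr1 A B ∘ h_leg E.
Definition h_r A B (E : hspan A B) : hom (h_ob E) B 0 := pr2 A B ∘ h_leg E.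

Fact isofib_h_l A B (E : hspan A B) : isofib (h_l E).
Proof. exact: isofib_comp (isofib_pr1 A B) (h_isofib E). Qed.

Fact isofib_h_r A B (E : hspan A B) : isofib (h_r E).
Proof. exact: isofib_comp (isofib_pr2 A B) (h_isofib E). Qed.

(** ** Modules *)

Section Module.
Variables (A B : K) (E : hspan A B).

Definition h_over_l : over A := Over (isofib_h_l E).
Definition prod_over_l : over A := Over (isofib_pr1 A B).
Definition h_over_r : over B := Over (isofib_h_r E).
Definition prod_over_r : over B := Over (isofib_pr2 A B).
Definition h_over : over (xprod A B) := Over (h_isofib E).

Fact leg_l_subproof :
  postc (h_ob E) (pr1 A B) 0 (h_leg E) = deg 0 (h_l E).
Proof. by rewrite /= !deg0. Qed.

Fact leg_r_subproof :
  postc (h_ob E) (pr2 A B) 0 (h_leg E) = deg 0 (h_r E).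
Proof. by rewrite /= !deg0. Qed.

(** The isofibration [E ->> A x B] as a functor in [K/A] and in [K/B]. *)
Definition leg_over_l : @hom (slice A) h_over_l prod_over_l 0 :=
  exist _ (h_leg E) leg_l_subproof.
Definition leg_over_r : @hom (slice B) h_over_r prod_over_r 0 :=
  exist _ (h_leg E) leg_r_subproof.

Definition is_module : Prop :=
  [/\ cartesian_fibration leg_over_l, cocartesian_fibration leg_over_r
    & @groupoidal (slice (xprod A B)) h_over].

End Module.

(** ** Comma infinity-categories *)

Fact fin_pres_Delta1 : fin_pres (Delta 1).
Proof.
exists {m : 'I_2 & dmor m 1},
  (fun z => existT (fun n => Delta 1 n) (nat_of_ord (tag z)) (tagged z)).
move=> m x nd.
have m2 : m < 2.
  rewrite ltnS; apply: (nd 1 x (did 1)).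
  by apply: dmorP => i /=; rewrite dcompE didE.
by exists (Tagged (fun m : 'I_2 => dmor m 1) (i := Ordinal m2) x).
Qed.

(** The simplicial set with two points, used to see that evaluation at both
    ends of an arrow is an isofibration. *)
Definition two_pts : sset :=
  @SSet (fun=> bool) (fun m n t b => b) (fun n b => erefl)
    (fun m n p t s b => erefl).

Fact fin_pres_two_pts : fin_pres two_pts.
Proof.
exists bool, (fun b => existT two_pts 0 b) => n x nd.
have n0 : n <= 0 by exact: (nd 0 (dconst n 0 ord0) x).
by move: n0 x nd; rewrite leqn0 => /eqP -> x _; exists x.
Qed.

Definition vertex (b : bool) : 'I_2 := if b then ord_max else ord0.

Definition ends : smap two_pts (Delta 1).
Proof.
exists (fun n b => dconst n 1 (vertex b)).
abstract by move=> m n t b; apply: dmorP => i; rewrite dcompE !dconstE.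
Defined.

Fact ends_mono : smono ends.
Proof.
move=> n b c /= /(congr1 (fun t => dfun t ord0)); rewrite !dconstE.
by case: b c => [] [].
Qed.

Section Arrow.
Variable A : K.

Definition arrowP : cotensor (Delta 1) A := cot A fin_pres_Delta1.
Definition arrow : K := cot_ob arrowP.

Definition ev0 : hom arrow A 0 := cot_cone arrowP 0 (dconst 0 1 ord0).
Definition ev1 : hom arrow A 0 := cot_cone arrowP 0 (dconst 0 1 ord_max).

Definition arrow_ends : hom arrow (xprod A A) 0 := xpair ev1 ev0.

(** The generic 2-cell [ev0 => ev1]. *)
Definition arrow_cell : hom arrow A 1 := cot_cone arrowP 1 (did 1).

Let S := cot A fin_pres_two_pts.
Let T := cot pt fin_pres_two_pts.
Let T' := cot pt fin_pres_Delta1.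
Let f := cot_pre ends T' T.
Let p := cot_post S T (to_pt A).

Let to_pt_cot U (P : cotensor U pt) X n (x y : hom X (cot_ob P) n) : x = y.
Proof. by apply: cot_uniq => *; apply: to_pt_eq. Qed.

Let two_cone X n (a b : hom X A n) : smap (sprod two_pts (Delta n)) (hom X A).
Proof.
exists (fun m z => act z.2 (if z.1 then a else b)).
by move=> m q t [u s] /=; rewrite act_comp.
Defined.

Let c u := cot_cone S 0 u.

Let cone_deg n u : cot_cone S n u = deg n (c u).
Proof. by rewrite /deg -sfun_act. Qed.

Let prod_two : hom (xprod A A) (cot_ob S) 0 :=
  cot_lift S (two_cone (pr1 A A) (pr2 A A)).

Let c_prod_two u : c u ∘ prod_two = if u then pr1 A A else pr2 A A.
Proof.
have := cot_beta S (two_cone (pr1 A A) (pr2 A A)) (u : two_pts 0) (did 0).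
by rewrite /= !act_id.
Qed.

Let to_T' : hom (xprod A A) (cot_ob T') 0 :=
  cot_lift0 T' (SMap (sfun := fun n _ => deg n (to_pt (xprod A A)))
    (fun m n t _ => esym (act_deg t _))).

Let lift X n (e : hom X (cot_ob S) n) : hom X (xprod A A) n :=
  xpair (c true *> e) (c false *> e).

Let lift_r X n (e : hom X (cot_ob S) n) : prod_two *> lift e = e.
Proof.
apply: cot_uniq => m u t; rewrite cone_deg scomp_act act_deg scompA -deg_comp.
rewrite c_prod_two; case: u; rewrite -(act_deg t) -scomp_act ?pair1 ?pair2;
  by rewrite scomp_act act_deg.
Qed.

Let lift_uniq X n (x y : hom X (xprod A A) n) :
  prod_two *> x = prod_two *> y -> x = y.
Proof.
move=> H; have E u : (c u ∘ prod_two) *> x = (c u ∘ prod_two) *> y.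
  by rewrite deg_comp -!scompA H.
by apply: prod_ext; [have := E true | have := E false]; rewrite c_prod_two.
Qed.

Let P : pullback f p :=
  @Pullback K _ _ _ f p (xprod A A) to_T' prod_two (to_pt_cot _ _)
    (fun X n a e _ => lift e)
    (fun X n a e _ => to_pt_cot _ _)
    (fun X n a e _ => lift_r e)
    (fun X n x y _ H => lift_uniq H).

Fact isofib_arrow_ends : isofib arrow_ends.
Proof.
unshelve eapply (@isofib_leibniz K _ _ (to_pt A) two_pts (Delta 1)
  fin_pres_two_pts fin_pres_Delta1 ends P arrow_ends).
- exact: isofib_bang.
- exact: ends_mono.
- exact: to_pt_cot.
- apply: cot_uniq => m u t; rewrite cot_beta /= cone_deg -(act_deg t).
  rewrite -scomp_act deg0 scompA c_prod_two.
  have -> : (if u then pr1 A A else pr2 A A) ∘ arrow_ends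
      = cot_cone arrowP 0 (ends 0 u).
    by case: u; [have := pair1 ev1 ev0 | have := pair2 ev1 ev0]; rewrite deg0.
  rewrite -sfun_act; congr (cot_cone _ m _); apply: dmorP => i.
  by rewrite dcompE !dconstE.
Qed.

End Arrow.

Section Comma.
Variables (A B C : K) (f : hom B A 0) (g : hom C A 0).

Definition commaP : pullback (prod_map g f) (arrow_ends A) :=
  pb (prod_map g f) (isofib_arrow_ends A).

Definition comma : hspan C B :=
  @HSpan C B (pb_ob commaP) (pb_fst commaP)
    (isofib_pb commaP (isofib_arrow_ends A)).

Definition comma_p1 : hom (h_ob comma) C 0 := h_l comma.
Definition comma_p0 : hom (h_ob comma) B 0 := h_r comma.

(** The canonical 2-cell [f p0 => g p1]. *)
Definition comma_cell : hom (h_ob comma) A 1 :=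
  arrow_cell A <* pb_snd commaP.

(** [a] is induced by the 2-cell [alpha : f b => g c]. *)
Definition induced X (c : hom X C 0) (b : hom X B 0) (alpha : hom X A 1)
    (a : hom X (h_ob comma) 0) : Prop :=
  [/\ comma_p1 ∘ a = c, comma_p0 ∘ a = b
    & homotopic (comma_cell <* a) alpha].

End Comma.

(** ** The virtual double category of modules *)

Record span A B := Span {
  sp_ob : K;
  sp_l : hom sp_ob A 0;
  sp_r : hom sp_ob B 0 }.

Definition id_span A : span A A := Span (idm A) (idm A).

Definition compP A B C (E : hspan A B) (S : span B C) :
  pullback (sp_l S) (h_r E) := pb (sp_l S) (isofib_h_r E).

Definition comp_span A B C (E : hspan A B) (S : span B C) : span A C :=
  Span (h_l E ∘ pb_snd (compP E S)) (sp_r S ∘ pb_fst (compP E S)).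

(** Composable sequences of spans.  Being a module is imposed separately, by
    [all_modules], so that comma infinity-categories (which are modules) can
    occur in a sequence without a proof of that fact. *)
Inductive hseq : K -> K -> Type :=
| hnil A : hseq A A
| hcons A B C of hspan A B & hseq B C : hseq A C.

Fixpoint all_modules A B (s : hseq A B) : Prop :=
  match s with
  | hnil _ => True
  | hcons _ _ _ E s' => is_module E /\ all_modules s'
  end.

(** [E_1 x_{A_1} ... x_{A_(n-1)} E_n x_{A_n} S].  The iterated pullback of [s]
    alone is [ext s (id_span B)], and that of a concatenation of [s] and [t] is
    [ext s (ext t (id_span C))]. *)
Fixpoint ext A B (s : hseq A B) : forall C, span B C -> span A C :=
  match s in hseq A B return forall C, span B C -> span A C with
  | hnil _ => fun C S => S
  | hcons _ _ _ E s' => fun C S => comp_span E (ext s' S)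
  end.

Definition total A B (s : hseq A B) : span A B := ext s (id_span B).

Fixpoint ext_proj A B (s : hseq A B) :
    forall C (S : span B C), hom (sp_ob (ext s S)) (sp_ob S) 0 :=
  match s in hseq A B return
    forall C (S : span B C), hom (sp_ob (ext s S)) (sp_ob S) 0 with
  | hnil _ => fun C S => idm (sp_ob S)
  | hcons _ _ _ E s' => fun C S => ext_proj s' S ∘ pb_fst (compP E (ext s' S))
  end.

(** Functors between the apexes of two spans that commute with the left legs. *)
Record lmap B C C' (S : span B C) (S' : span B C') := LMap {
  lm :> hom (sp_ob S) (sp_ob S') 0;
  lm_l : sp_l S' ∘ lm = sp_l S }.

Section CompMap.
Variables (A B C C' : K) (E : hspan A B) (S : span B C) (S' : span B C').
Variable u : lmap S S'.

Fact comp_map_subproof :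
  sp_l S' *> (u ∘ pb_fst (compP E S)) = h_r E *> pb_snd (compP E S).
Proof. by rewrite !deg0 scompA lm_l pb_eq. Qed.

Definition comp_map_fun := pb_lift (compP E S') comp_map_subproof.

Fact comp_map_l : sp_l (comp_span E S') ∘ comp_map_fun = sp_l (comp_span E S).
Proof.
rewrite /= -scompA -[pb_snd (compP E S')]deg0.
by rewrite /comp_map_fun pb_liftr.
Qed.

Definition comp_map : lmap (comp_span E S) (comp_span E S') :=
  @LMap _ _ _ (comp_span E S) (comp_span E S') comp_map_fun comp_map_l.

End CompMap.

(** [E_1 x ... x E_n x -] as a functor on such maps. *)
Fixpoint ext_map A B (s : hseq A B) : forall C C' (S : span B C)
    (S' : span B C'), lmap S S' -> lmap (ext s S) (ext s S') :=
  match s in hseq A B return forall C C' (S : span B C) (S' : span B C'),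
    lmap S S' -> lmap (ext s S) (ext s S') with
  | hnil _ => fun C C' S S' u => u
  | hcons _ _ _ E s' => fun C C' S S' u => comp_map E (ext_map s' u)
  end.

(** The left leg of [S], as a map from [S] to the identity span. *)
Definition to_id B C (S : span B C) : lmap S (id_span B).
Proof.
exists (sp_l S).
exact: scomp_id0l.
Defined.

(** A cell with source [S] (an iterated pullback of horizontal arrows), target
    [F] and vertical boundaries [f] and [g] is an isomorphism class of vertices
    of the following fibre; cells are handled through representatives, and their
    equality is [isomorphic]. *)
Definition cells A A' B B' (S : span A A') (F : hspan B B') (f : hom A B 0)
    (g : hom A' B' 0) : sset :=
  fibre (postc (sp_ob S) (h_leg F)) (xpair (f ∘ sp_l S) (g ∘ sp_r S)).

Fact cells_leg A A' B B' (S : span A A') (F : hspan B B') (f : hom A B 0)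
    (g : hom A' B' 0) (c : cells S F f g 0) :
  h_leg F ∘ sval c = xpair (f ∘ sp_l S) (g ∘ sp_r S).
Proof. by case: c => x /=; rewrite !deg0. Qed.

Definition globular A B (S : span A B) (E : hspan A B) : sset :=
  cells S E (idm A) (idm B).

Section Whisker.
Variables (A B : K) (s : hseq A B) (E : hspan A B).
Variable nu : globular (total s) E 0.

Fact ext_proj_map A0 B0 (t : hseq A0 B0) C C' (S : span B0 C) (S' : span B0 C')
    (u : lmap S S') :
  ext_proj t S' ∘ ext_map t u = u ∘ ext_proj t S.
Proof.
elim: t C C' S S' u => [D|D D' D'' G t IH] C C' S S' u /=.
  by rewrite scomp_id0l scomp_id0r.
rewrite -scompA -[pb_fst _ in LHS]deg0 /comp_map_fun pb_liftl.
by rewrite !scompA IH.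
Qed.

Fact ext_r A0 B0 (t : hseq A0 B0) C (S : span B0 C) :
  sp_r (ext t S) = sp_r S ∘ ext_proj t S.
Proof.
elim: t C S => [D|D D' D'' G t IH] C S /=.
  by rewrite scomp_id0r.
by rewrite IH scompA.
Qed.

Fact nu_l : h_l E ∘ sval nu = sp_l (total s).
Proof.
by rewrite /h_l -scompA cells_leg -[pr1 A B]deg0 pair1 scomp_id0l.
Qed.

Fact nu_r : h_r E ∘ sval nu = sp_r (total s).
Proof.
by rewrite /h_r -scompA cells_leg -[pr2 A B]deg0 pair2 scomp_id0l.
Qed.

Variables (C : K) (S : span B C).

Let nu_S := sval nu ∘ ext_map s (to_id S).

Fact whisker_r_subproof : sp_l S *> ext_proj s S = h_r E *> nu_S.
Proof.
rewrite !deg0 /nu_S scompA nu_r ext_r -scompA ext_proj_map /=.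
by rewrite scompA scomp_id0l.
Qed.

Definition whisker_r_fun : hom (sp_ob (ext s S)) (sp_ob (comp_span E S)) 0 :=
  pb_lift (compP E S) whisker_r_subproof.

Fact whisker_r_l : sp_l (comp_span E S) ∘ whisker_r_fun = sp_l (ext s S).
Proof.
rewrite /= -scompA -[pb_snd _]deg0 /whisker_r_fun pb_liftr /nu_S.
by rewrite scompA nu_l lm_l.
Qed.

(** [nu x S]. *)
Definition whisker_r : lmap (ext s S) (comp_span E S) :=
  @LMap _ _ _ (ext s S) (comp_span E S) whisker_r_fun whisker_r_l.

End Whisker.

(** [(id, ..., id, nu, id, ..., id)]. *)
Definition whisker A0 A B B0 (l : hseq A0 A) (s : hseq A B) (E : hspan A B)
    (nu : globular (total s) E 0) (r : hseq B B0) :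
  lmap (ext l (ext s (total r))) (ext l (comp_span E (total r))) :=
  ext_map l (whisker_r nu (total r)).

Definition is_composite A B (s : hseq A B) (E : hspan A B)
    (nu : globular (total s) E 0) : Prop :=
  forall A0 (l : hseq A0 A) B0 (r : hseq B B0),
    all_modules l -> all_modules r ->
  forall C C' (H : hspan C C') (f : hom A0 C 0) (g : hom B0 C' 0),
    is_module H ->
  forall chi : cells (ext l (ext s (total r))) H f g 0,
    let factors (chi' : cells (ext l (comp_span E (total r))) H f g 0) :=
      exists chi'' : cells (ext l (ext s (total r))) H f g 0,
        sval chi'' = sval chi' ∘ whisker l nu r /\ isomorphic chi'' chi in
    exists chi', factors chi' /\
      forall chi0, factors chi0 -> isomorphic chi0 chi'.

(** ** Exact squares and initial functors *)

Section Exact.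
Variables (A B C D : K).
Variables (f : hom B A 0) (g : hom C A 0) (h : hom D B 0) (k : hom D C 0).

Definition comma_l : hspan C D := comma k (idm C).
Definition comma_r : hspan D B := comma (idm B) h.

Definition exact_source : hseq C B :=
  hcons comma_l (hcons comma_r (hnil B)).

Let T := sp_ob (total exact_source).
Let S := comp_span comma_r (id_span B).

Definition exact_pr_l : hom T (h_ob comma_l) 0 := pb_snd (compP comma_l S).
Definition exact_pr_r : hom T (h_ob comma_r) 0 :=
  pb_snd (compP comma_r (id_span B)) ∘ pb_fst (compP comma_l S).

(** [alpha] represents the pasting of [f phi], [lambda] and [g phi']. *)
Definition exact_pasting (lambda : hom D A 1) (alpha : hom T A 1) : Prop :=
  exists beta : hom T A 1,
    composes (f *> comma_cell (idm B) h <* exact_pr_r)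
             (lambda <* (comma_p1 (idm B) h ∘ exact_pr_r)) beta /\
    composes beta (g *> comma_cell k (idm C) <* exact_pr_l) alpha.

(** All [nu] as below represent the same cell. *)
Definition exact_square (lambda : hom D A 1) : Prop :=
  [/\ src lambda = f ∘ h, tgt lambda = g ∘ k &
  exists (alpha : hom T A 1) (nu : globular (total exact_source) (comma f g) 0),
    [/\ exact_pasting lambda alpha,
        induced (sp_l (total exact_source)) (sp_r (total exact_source))
          alpha (sval nu)
      & is_composite nu]].

End Exact.

Definition initial A B (k : hom A B 0) : Prop :=
  exact_square (idm pt) (to_pt B) (to_pt A) k (deg 1 (idm pt ∘ to_pt A)).

End Cosmos.

(* Main.v *)
From mathcomp Require Import all_boot.
From mathcomp Require Import zify.
Require Import Defs.

Set Implicit Arguments.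
Unset Strict Implicit.
Unset Printing Implicit Defensive.
Local Open Scope cosmos_scope.

(** A cone over [f : B -> C] with summit a generalised element [q : X -> C] is
    a 2-cell on [X x B] from [q pr1] to [f pr2], and a limit cone is one
    through which all of these factor uniquely ([is_limitE]). The theorem
    holds because restriction along an initial functor [k : A -> B] is a
    bijection from the cones over [f] with summit [q] to those over [f k] with
    summit [q] ([product_restriction]), and this bijection commutes with
    composition by 2-cells into [q]. So a cone over [f] is universal iff its
    restriction is, and every cone over [f k] is the restriction of one with
    the same summit.

    Transposing the parameter [X] into the exponential [C^X], it is enough to
    treat cones [c ! => g : B -> D] whose summit is a point [c : 1 -> D] of an
    arbitrary object ([initial_restriction]). Initiality of [k] says that the
    cell from the comma [k | B] to [B], seen as a module from [B] to [1], is a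
    composite. Its universal property is tested on the arrows of [D]: cells
    into that module with boundaries [g] and [c] are exactly the cones over
    [g] ([isomorphic_edge]). Hence cones over [g] correspond to cones over [g
    t], where [t] is the projection of [k | B] to [B]. With [q] the projection
    to [A] and [phi : k q => t] the canonical 2-cell, interchange shows that a
    cone over [g t] that comes from [B] is determined by its restriction to
    [A]; conversely a cone [b] over [g k] gives the cone [g phi . b q] over [g
    t], which restricts to [b] along the section of [q] that picks out
    identities.

    The test is legitimate because the arrows of [D] do form a module
    ([arrow_module]). The simplices involved are squares, that is maps from a
    product with [Delta 1]. Every square, cut along its diagonal, is the
    composite of two triangles ([split_sq]). A triangle along which both ends
    of the arrow stay fixed is invertible over these ends ([thin_initial_iso],
    [thin_final_iso]); so arrows with fixed ends form a groupoid, and when one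
    end is fixed, each edge is a triangle up to an isomorphism that fixes
    both. For triangles, the cartesian and cocartesian lifting properties are
    fillings of inner horns in dimension 3, while for squares they would be
    fillings of special outer horns. *)

(** * Horns in a quasi-category *)

Lemma mkdE m n f H i : dfun (@mkd m n f H) i = f i.
Proof. by rewrite /dfun /= ffunE. Qed.

Lemma dcomp_id m n (t : dmor m n) : dcomp t (did m) = t.
Proof. by apply: dmorP => i; rewrite dcompE didE. Qed.

Lemma id_dcomp m n (t : dmor m n) : dcomp (did n) t = t.
Proof. by apply: dmorP => i; rewrite dcompE didE. Qed.

Lemma dcompA m n p q (t : dmor p q) (s : dmor n p) (r : dmor m n) :
  dcomp t (dcomp s r) = dcomp (dcomp t s) r.
Proof. by apply: dmorP => i; rewrite !dcompE. Qed.

Lemma dfaceE n k i : dfun (@dface n k) i = lift k i.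
Proof. exact: mkdE. Qed.

Section HornFilling.

Fact dcollapse_subproof n (j : 'I_n.+2) (x y : 'I_n.+2) : x <= y ->
  @inord n (minn (unbump j x) n) <= @inord n (minn (unbump j y) n).
Proof. by move=> xy; rewrite !inordK /unbump; lia. Qed.

(** The codegeneracy that retracts [dface j]. The bound only matters when [j] is
    the last vertex, which is then identified with its predecessor. *)
Definition dcollapse n (j : 'I_n.+2) : dmor n.+1 n :=
  mkd (@dcollapse_subproof n j).

Lemma dface_collapse m n (j : 'I_n.+2) (t : dmor m n.+1) :
  (forall i, dfun t i != j) -> dcomp (dface j) (dcomp (dcollapse j) t) = t.
Proof.
move=> H; apply: dmorP => i; rewrite !dcompE dfaceE mkdE.
move: (H i); move: (dfun t i) => x xj; apply: val_inj => /=.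
have xj' : x <> j :> nat by move=> /val_inj e; rewrite e eqxx in xj.
by rewrite inordK /bump /unbump; have := ltn_ord x; have := ltn_ord j; lia.
Qed.

Lemma dface_inj m n (j : 'I_n.+2) (a b : dmor m n) :
  dcomp (dface j) a = dcomp (dface j) b -> a = b.
Proof.
move=> e; apply: dmorP => i; apply: (@lift_inj _ j).
by rewrite -!dfaceE -!dcompE e.
Qed.

Lemma dface_face n (i j : 'I_n.+3) (i' j' : 'I_n.+2) :
  i < j -> i' = i :> nat -> j'.+1 = j ->
  dcomp (dface j) (dface i') = dcomp (dface i) (dface j').
Proof.
move=> ij ei ej; apply: dmorP => x; apply: val_inj.
by rewrite !dcompE !dfaceE /= /bump; lia.
Qed.

(** The matching condition is the cosimplicial identity [dface_face] read on
    the faces [s i] and [s j.+1]. *)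
Lemma horn_fill (X : sset) (qX : is_qcat X) n (k : 'I_n.+3) (hk : 0 < k < n.+2)
    (s : nat -> X n.+1) :
  (forall i j : 'I_n.+2, i <= j -> i != k :> nat -> j.+1 != k ->
     act (dface j) (s i) = act (dface i) (s j.+1)) ->
  exists W : X n.+2, forall i : 'I_n.+3, i != k -> act (dface i) W = s i.
Proof.
move=> H.
have compat_lt m (i j : 'I_n.+3) (a b : dmor m n.+1) : i != k -> j != k ->
    i < j -> dcomp (dface i) a = dcomp (dface j) b -> act a (s i) = act b (s j).
  move=> ik jk ij e.
  have Hi : i < n.+2 by have := ltn_ord j; lia.
  have Hj : j.-1 < n.+2 by have := ltn_ord j; lia.
  pose i' : 'I_n.+2 := Ordinal Hi; pose j' : 'I_n.+2 := Ordinal Hj.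
  have ej : j'.+1 = j by rewrite /=; lia.
  pose c := dcomp (dcollapse j') a.
  have ea : dcomp (dface j') c = a.
    apply: dface_collapse => x; apply/eqP => axj.
    have := congr1 (fun t => dfun t x) e; rewrite !dcompE !dfaceE axj.
    by move/(congr1 val); rewrite /= /bump; lia.
  have eb : dcomp (dface i') c = b.
    apply: (@dface_inj _ _ j); rewrite -e -ea !dcompA.
    by rewrite (@dface_face _ i j i' j').
  rewrite -ea -eb !act_comp -ej (H i' j') // ?ej //.
  by rewrite -ltnS ej.
have compat m (i j : 'I_n.+3) (a b : dmor m n.+1) : i != k -> j != k ->
    dcomp (dface i) a = dcomp (dface j) b -> act a (s i) = act b (s j).
  move=> ik jk e; case: (ltngtP i j) => ij.
  - exact: compat_lt.
  - exact/esym/compat_lt.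
  - by move/val_inj: ij e => -> /dface_inj ->.
(* A simplex of the horn factors through a face that it lies in; by [compat],
   its value does not depend on the choice of that face. *)
pose omit m (t : horn k m) := sigW (existsP (valP t)).
pose u m (t : horn k m) : X m :=
  act (dcomp (dcollapse (sval (omit m t))) (sval t)) (s (sval (omit m t))).
have uE m (t : horn k m) j a : j != k -> sval t = dcomp (dface j) a ->
    u m t = act a (s j).
  move=> jk e; rewrite /u; case: (omit m t) => i /= /andP[ik /forallP Hi].
  by apply: compat => //; rewrite dface_collapse.
have u_act m p (r : dmor m p) (t : horn k p) : u m (act r t) = act r (u p t).
  rewrite [in RHS]/u -act_comp; case: (omit p t) => i /= /andP[ik /forallP Hi].
  by apply: uE => //; rewrite dcompA dface_collapse.
have [w wP] := qX _ k hk (SMap u_act).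
exists (w n.+2 (did n.+2)) => i ik; rewrite -sfun_act /= id_dcomp.
have hi : in_horn k (dface i).
  apply/existsP; exists i; rewrite ik; apply/forallP => x.
  by rewrite dfaceE eq_sym neq_lift.
apply: etrans (wP n.+1 (exist _ (dface i) hi)) _.
by rewrite /= (uE _ _ i (did _)) ?act_id //= dcomp_id.
Qed.

End HornFilling.

Definition o3 (i : nat) : 'I_4 := inord i.

Definition face3 (X : sset) (i : nat) (W : X 3) : X 2 := act (dface (o3 i)) W.

(* Decides equality of two concrete monotone maps, vertex by vertex. *)
Ltac dcase :=
  apply: dmorP; case=> [[|[|[|[|?]]]] ?] //;
  rewrite ?dcompE ?dfaceE ?dconstE ?didE ?mkdE; apply: val_inj => /=;
  rewrite ?inordK //=.

Section Faces.
Variable X : sset.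
Implicit Types (f g h : X 1) (s : X 2) (W : X 3).

Lemma src_d2 s : src (d2 s) = src (d1 s).
Proof. by rewrite /src -!act_comp; congr act; dcase. Qed.
Lemma tgt_d2 s : tgt (d2 s) = src (d0 s).
Proof. by rewrite /src /tgt -!act_comp; congr act; dcase. Qed.
Lemma tgt_d1 s : tgt (d1 s) = tgt (d0 s).
Proof. by rewrite /tgt -!act_comp; congr act; dcase. Qed.

Lemma src_deg (x : X 0) : src (deg 1 x) = x.
Proof. by rewrite /src act_deg deg0. Qed.
Lemma tgt_deg (x : X 0) : tgt (deg 1 x) = x.
Proof. by rewrite /tgt act_deg deg0. Qed.
Lemma deg1_inj (x y : X 0) : deg 1 x = deg 1 y -> x = y.
Proof. by move/(congr1 (@src X)); rewrite !src_deg. Qed.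

Lemma d01 W : d0 (face3 1 W) = d0 (face3 0 W).
Proof. by rewrite /d0 /face3 -!act_comp; congr act; dcase. Qed.
Lemma d02 W : d0 (face3 2 W) = d1 (face3 0 W).
Proof. by rewrite /d0 /d1 /face3 -!act_comp; congr act; dcase. Qed.
Lemma d12 W : d1 (face3 2 W) = d1 (face3 1 W).
Proof. by rewrite /d1 /face3 -!act_comp; congr act; dcase. Qed.
Lemma d13 W : d1 (face3 3 W) = d2 (face3 1 W).
Proof. by rewrite /d1 /d2 /face3 -!act_comp; congr act; dcase. Qed.
Lemma d23 W : d2 (face3 3 W) = d2 (face3 2 W).
Proof. by rewrite /d2 /face3 -!act_comp; congr act; dcase. Qed.

Hypothesis qX : is_qcat X.

Lemma fill21 f g : tgt f = src g -> exists s, d2 s = f /\ d0 s = g.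
Proof.
move=> e; pose s i := if i == 0 then g else f.
have [|W HW] := @horn_fill X qX 0 (lift ord0 ord0) isT s.
  case=> [[|[|i]] hi] // [[|[|j]] hj] //= _ _ _; rewrite /s /=.
  move: e; rewrite /tgt /src => e.
  have -> : dface (Ordinal hj) = dconst 0 1 ord0 by dcase.
  by rewrite -e; congr act; dcase.
by exists W; split; exact: HW.
Qed.

Lemma fill31 (s0 s2 s3 : X 2) : d0 s2 = d1 s0 -> d0 s3 = d2 s0 ->
  d2 s3 = d2 s2 ->
  exists W, [/\ face3 0 W = s0, face3 2 W = s2 & face3 3 W = s3].
Proof.
move=> e02 e03 e23; pose s i := nth s0 [:: s0; s0; s2; s3] i.
have k1 : o3 1 = 1 :> nat by rewrite inordK.
have [||W HW] := @horn_fill X qX 1 (o3 1) _ s; first by rewrite k1.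
  case=> [[|[|[|i]]] hi] // [[|[|[|j]]] hj] //; rewrite k1 => //= _ _ _.
  - transitivity (d1 s0); [|rewrite -e02]; rewrite /d1 /d0 /s /=;
      by congr act; dcase.
  - transitivity (d2 s0); [|rewrite -e03]; rewrite /d2 /d0 /s /=;
      by congr act; dcase.
  - transitivity (d2 s2); [|rewrite -e23]; rewrite /d2 /s /=;
      by congr act; dcase.
by exists W; split; rewrite /face3 HW -?val_eqE /= ?inordK.
Qed.

Lemma fill32 (s0 s1 s3 : X 2) : d0 s1 = d0 s0 -> d0 s3 = d2 s0 ->
  d1 s3 = d2 s1 ->
  exists W, [/\ face3 0 W = s0, face3 1 W = s1 & face3 3 W = s3].
Proof.
move=> e01 e03 e13; pose s i := nth s0 [:: s0; s1; s1; s3] i.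
have k2 : o3 2 = 2 :> nat by rewrite inordK.
have [||W HW] := @horn_fill X qX 1 (o3 2) _ s; first by rewrite k2.
  case=> [[|[|[|i]]] hi] // [[|[|[|j]]] hj] //; rewrite k2 => //= _ _ _.
  - transitivity (d0 s0); [|rewrite -e01]; rewrite /d0 /s /=;
      by congr act; dcase.
  - transitivity (d2 s0); [|rewrite -e03]; rewrite /d2 /d0 /s /=;
      by congr act; dcase.
  - transitivity (d2 s1); [|rewrite -e13]; rewrite /d1 /d2 /s /=;
      by congr act; dcase.
by exists W; split; rewrite /face3 HW -?val_eqE /= ?inordK.
Qed.

End Faces.

(** * The homotopy category of a quasi-category *)

Fact dvec_subproof m n (s : seq nat) (i j : 'I_m.+1) : i <= j ->
  @inord n (minn n (foldr maxn 0 (take i.+1 s))) <=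
  @inord n (minn n (foldr maxn 0 (take j.+1 s))).
Proof.
move=> ij; rewrite !inordK ?ltnS ?geq_minl // leq_min geq_minl /=.
apply: leq_trans (geq_minr _ _) _.
have -> : take i.+1 s = take i.+1 (take j.+1 s) by rewrite take_takel.
rewrite -{2}(cat_take_drop i.+1 (take j.+1 s)) foldr_cat.
by elim: (take i.+1 _) => //= x r IH; rewrite geq_max leq_maxl leq_max IH orbT.
Qed.

(** The monotone map with vertices [s]; truncation and the running maximum
    make it total in [s], so that concrete maps need no side condition. *)
Definition dvec m n (s : seq nat) : dmor m n := mkd (@dvec_subproof m n s).
Arguments dvec : clear implicits.

Section Composition.
Variable X : sset.
Implicit Types (f g h u v w : X 1).

Definition degl f : X 2 := act (dvec 2 1 [:: 0; 0; 1]) f.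
Definition degr f : X 2 := act (dvec 2 1 [:: 0; 1; 1]) f.

Lemma degl_deg (x : X 0) : degl (deg 1 x) = deg 2 x.
Proof. exact: act_deg. Qed.
Lemma degr_deg (x : X 0) : degr (deg 1 x) = deg 2 x.
Proof. exact: act_deg. Qed.
Lemma d0_deg (x : X 0) : d0 (deg 2 x) = deg 1 x.
Proof. exact: act_deg. Qed.
Lemma d1_deg (x : X 0) : d1 (deg 2 x) = deg 1 x.
Proof. exact: act_deg. Qed.
Lemma d2_deg (x : X 0) : d2 (deg 2 x) = deg 1 x.
Proof. exact: act_deg. Qed.

Lemma d0_degl f : d0 (degl f) = f.
Proof. by rewrite /d0 /degl -act_comp -[RHS]act_id; congr act; dcase. Qed.
Lemma d1_degl f : d1 (degl f) = f.
Proof. by rewrite /d1 /degl -act_comp -[RHS]act_id; congr act; dcase. Qed.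
Lemma d2_degl f : d2 (degl f) = deg 1 (src f).
Proof. by rewrite /d2 /degl /deg /src -!act_comp; congr act; dcase. Qed.
Lemma d0_degr f : d0 (degr f) = deg 1 (tgt f).
Proof. by rewrite /d0 /degr /deg /tgt -!act_comp; congr act; dcase. Qed.
Lemma d1_degr f : d1 (degr f) = f.
Proof. by rewrite /d1 /degr -act_comp -[RHS]act_id; congr act; dcase. Qed.
Lemma d2_degr f : d2 (degr f) = f.
Proof. by rewrite /d2 /degr -act_comp -[RHS]act_id; congr act; dcase. Qed.

Lemma composes_idl f : composes (deg 1 (src f)) f f.
Proof. by exists (degl f); rewrite d0_degl d1_degl d2_degl. Qed.

Lemma composes_idr f : composes f (deg 1 (tgt f)) f.
Proof. by exists (degr f); rewrite d0_degr d1_degr d2_degr. Qed.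

Lemma composes_src f g h : composes f g h -> src h = src f.
Proof. by case=> s [<- _ <-]; rewrite src_d2. Qed.
Lemma composes_tgt f g h : composes f g h -> tgt h = tgt g.
Proof. by case=> s [_ <- <-]; rewrite tgt_d1. Qed.
Lemma composes_mid f g h : composes f g h -> tgt f = src g.
Proof. by case=> s [<- <- _]; rewrite tgt_d2. Qed.

Hypothesis qX : is_qcat X.

Lemma composes_ex f g : tgt f = src g -> exists h, composes f g h.
Proof. by move=> /(fill21 qX)[s [<- <-]]; exists (d1 s), s. Qed.

(** The two directions fill the two inner horns of the 3-simplex with edges [f],
    [g], [h] along its spine. Together with the identity triangles, this one
    equivalence gives all the laws of the homotopy category. *)
Lemma composes_assoc f g h u v w : composes f g u -> composes g h v ->
  (composes u h w <-> composes f v w).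
Proof.
move=> [s3 [f3 g3 u3]] [s0 [g0 h0 v0]]; split=> [] [s [e2 e0 e1]].
- have [|||W [W0 W1 W3]] := @fill32 X qX s0 s s3; try congruence.
  by exists (face3 2 W); split; rewrite -?d23 ?d02 ?d12; congruence.
- have [|||W [W0 W2 W3]] := @fill31 X qX s0 s s3; try congruence.
  by exists (face3 1 W); split; rewrite -?d13 ?d01 -?d12; congruence.
Qed.

Lemma homotopic_refl f : homotopic f f.
Proof. exact: composes_idr. Qed.

Lemma homotopic_src f g : homotopic f g -> src f = src g.
Proof. by move/composes_src. Qed.
Lemma homotopic_tgt f g : homotopic f g -> tgt f = tgt g.
Proof. by move/composes_tgt; rewrite tgt_deg. Qed.

Lemma composes_id (x : X 0) : composes (deg 1 x) (deg 1 x) (deg 1 x).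
Proof. by have := composes_idl (deg 1 x); rewrite src_deg. Qed.

Lemma homotopic_sym f g : homotopic f g -> homotopic g f.
Proof.
move=> fg; rewrite /homotopic -(homotopic_tgt fg).
by apply/(composes_assoc _ fg (composes_id _)); apply: composes_idr.
Qed.

Lemma homotopic_trans f g h : homotopic f g -> homotopic g h -> homotopic f h.
Proof.
move=> fg; rewrite {1}/homotopic -(homotopic_tgt fg).
by move/(composes_assoc _ fg (composes_id _)).
Qed.

Lemma homotopicE f g : homotopic f g <-> composes (deg 1 (src f)) f g.
Proof.
by apply: iff_sym; apply: iff_trans (iff_sym
  (composes_assoc _ (composes_idl f) (composes_idr f))) _.
Qed.

Lemma composes_homotopic f g h w : composes f g h ->
  (composes f g w <-> homotopic h w).
Proof.
move=> c; rewrite /homotopic (composes_tgt c).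
by apply: iff_sym; apply: composes_assoc c (composes_idr g).
Qed.

Lemma composes_congr f g h f' g' h' : homotopic f f' -> homotopic g g' ->
  homotopic h h' -> composes f g h -> composes f' g' h'.
Proof.
move=> ff gg hh c.
have c1 : composes f g h' by apply/(composes_homotopic _ c).
have c2 : composes f g' h'.
  have /homotopicE gg' := homotopic_sym gg.
  have := composes_mid c; move: (gg') => /[dup] /composes_mid; rewrite tgt_deg.
  move=> e g'g m; apply/(composes_assoc h' (composes_idr f)); last exact: c1.
  by rewrite m -(homotopic_src (homotopic_sym gg)) in g'g *.
have f'f : composes f' (deg 1 (src g')) f.
  by rewrite -(composes_mid c2) (homotopic_tgt ff); apply: homotopic_sym.
by apply/(composes_assoc _ f'f (composes_idl g')).
Qed.

End Composition.

Section Isomorphisms.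
Variables (X : sset) (qX : is_qcat X).
Implicit Types (f g h u v w : X 1).

Lemma is_iso_comp f g h : is_iso f -> is_iso g -> composes f g h -> is_iso h.
Proof.
move=> [f' [ff' f'f]] [g' [gg' g'g]] c.
have m := composes_mid c.
have sf' : src f' = src g by rewrite -m (composes_mid ff').
have tg' : tgt g' = tgt f by rewrite m (composes_mid g'g).
have [h' c'] : exists h', composes g' f' h'.
  by apply: composes_ex => //; rewrite tg' (composes_mid ff').
exists h'; rewrite (composes_src c) (composes_tgt c); split.
- apply/(composes_assoc qX _ c _); last exact: ff'.
  by apply/(composes_assoc qX _ gg' c'); rewrite -sf'; apply: composes_idl.
- apply/(composes_assoc qX _ c' _); last exact: g'g.
  by apply/(composes_assoc qX _ f'f c); rewrite m; apply: composes_idl.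
Qed.

(** As in a monoid: the left inverse [g] of [f] has a left inverse itself, which
    must be [f]. *)
Lemma left_inverses (P : X 1 -> Prop) :
  (forall f, P f -> exists g, P g /\ composes f g (deg 1 (src f))) ->
  forall f, P f -> is_iso f.
Proof.
move=> H f /H[g [/H[h [_ gh]] fg]]; exists g; split=> //.
have e : src g = tgt f by rewrite (composes_mid fg).
have eg : tgt g = src f by rewrite -(composes_tgt fg) tgt_deg.
have fh : homotopic f h.
  rewrite /homotopic -e; apply/(composes_assoc qX _ fg gh).
  by rewrite -eg (composes_mid gh); apply: composes_idl.
have /(composes_congr qX _ _ _) := gh; rewrite e; apply.
- exact: homotopic_refl.
- exact: homotopic_sym.
- exact: homotopic_refl.
Qed.

Lemma right_inverses (P : X 1 -> Prop) :
  (forall f, P f -> exists g, P g /\ composes g f (deg 1 (tgt f))) ->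
  forall f, P f -> is_iso f.
Proof.
move=> H f /H[g [/H[h [_ gh]] fg]]; exists g; split=> //.
have e : tgt g = src f by rewrite (composes_mid fg).
have eg : src g = tgt f by rewrite -(composes_src fg) src_deg.
have fh : homotopic h f.
  rewrite /homotopic (composes_mid gh) eg; apply/(composes_assoc qX _ gh fg).
  by rewrite e; apply: composes_idl.
have /(composes_congr qX _ _ _) := gh; rewrite e; apply => //.
- exact: homotopic_refl.
- exact: homotopic_refl.
Qed.

End Isomorphisms.

Section Functoriality.
Variables (X Y : sset) (F : smap X Y).

Lemma smap_src f : src (F 1 f) = F 0 (src f).
Proof. by rewrite /src sfun_act. Qed.
Lemma smap_tgt f : tgt (F 1 f) = F 0 (tgt f).
Proof. by rewrite /tgt sfun_act. Qed.
Lemma smap_deg n x : F n (deg n x) = deg n (F 0 x).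
Proof. by rewrite /deg sfun_act. Qed.

Lemma smap_composes f g h : composes f g h -> composes (F 1 f) (F 1 g) (F 1 h).
Proof.
by move=> [s [<- <- <-]]; exists (F 2 s); rewrite /d0 /d1 /d2 !sfun_act.
Qed.

Lemma smap_homotopic f g : homotopic f g -> homotopic (F 1 f) (F 1 g).
Proof. by move/smap_composes; rewrite smap_deg -smap_tgt. Qed.

End Functoriality.

Section Whiskering.
Variable C : scat.

Lemma postc0 (X A B : C) (f : hom A B 0) (x : hom X A 0) :
  postc X f 0 x = f ∘ x.
Proof. by rewrite /= deg0. Qed.
Lemma postc_src (X A B : C) (f : hom A B 0) (x : hom X A 1) :
  src (f *> x) = f ∘ src x.
Proof. by rewrite (smap_src (postc X f)) postc0. Qed.
Lemma postc_tgt (X A B : C) (f : hom A B 0) (x : hom X A 1) :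
  tgt (f *> x) = f ∘ tgt x.
Proof. by rewrite (smap_tgt (postc X f)) postc0. Qed.

Lemma postc_d0 (X A B : C) (f : hom A B 0) (s : hom X A 2) :
  f *> d0 s = d0 (f *> s).
Proof. by rewrite /d0 scomp_act act_deg. Qed.
Lemma postc_d2 (X A B : C) (f : hom A B 0) (s : hom X A 2) :
  f *> d2 s = d2 (f *> s).
Proof. by rewrite /d2 scomp_act act_deg. Qed.

Definition prec (X Y Z : C) (v : hom X Y 0) : smap (hom Y Z) (hom X Z).
Proof.
exists (fun n x => x <* v).
abstract by move=> m n t x; rewrite scomp_act act_deg.
Defined.

Lemma prec_src (X Y Z : C) (v : hom X Y 0) (x : hom Y Z 1) :
  src (x <* v) = src x ∘ v.
Proof. by rewrite (smap_src (prec Z v)) /= deg0. Qed.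

Lemma prec_tgt (X Y Z : C) (v : hom X Y 0) (x : hom Y Z 1) :
  tgt (x <* v) = tgt x ∘ v.
Proof. by rewrite (smap_tgt (prec Z v)) /= deg0. Qed.

Lemma prec_comp (X Y Z W : C) (u : hom X Y 0) (v : hom Y Z 0) n
  (x : hom Z W n) : x <* v <* u = x <* (v ∘ u).
Proof. by rewrite -scompA deg_comp. Qed.

(** Interchange: both composites are the diagonal [a ∘ b]. *)
Lemma interchange_l (X Y Z : C) (a : hom Y Z 1) (b : hom X Y 1) :
  composes (src a *> b) (a <* tgt b) (a ∘ b).
Proof.
exists (degl a ∘ degr b); rewrite /d0 /d1 /d2 !scomp_act.
by rewrite -!/(d0 _) -!/(d1 _) -!/(d2 _) d2_degl d0_degl d1_degl d2_degr d0_degr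
  d1_degr.
Qed.

Lemma interchange_r (X Y Z : C) (a : hom Y Z 1) (b : hom X Y 1) :
  composes (a <* src b) (tgt a *> b) (a ∘ b).
Proof.
exists (degr a ∘ degl b); rewrite /d0 /d1 /d2 !scomp_act.
by rewrite -!/(d0 _) -!/(d1 _) -!/(d2 _) d2_degl d0_degl d1_degl d2_degr d0_degr
  d1_degr.
Qed.

End Whiskering.

(** * Squares: the simplices of functor spaces into an arrow object *)

Definition mono2 (c : nat -> nat -> nat) : Prop :=
  forall a a' b b', a <= a' -> b <= b' -> c a b <= c a' b'.

Section PairMap.
Variables (n N : nat) (c : nat -> nat -> nat) (hc : mono2 c).

Fact dpair_subproof m (u : dmor m 1) (t : dmor m n) (i j : 'I_m.+1) : i <= j ->
  @inord N (minn N (c (dfun u i) (dfun t i))) <=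
  @inord N (minn N (c (dfun u j) (dfun t j))).
Proof.
move=> ij; rewrite !inordK ?ltnS ?geq_minl // leq_min geq_minl /=.
by apply: leq_trans (geq_minr _ _) (hc _ _); apply: dmor_mono.
Qed.

(** A monotone map [c] of posets from [1] x [n] to [N] acts on the simplices of
    the product. As in [dvec], truncation spares a side condition on [c]. *)
Definition dpair m (u : dmor m 1) (t : dmor m n) : dmor m N :=
  mkd (@dpair_subproof m u t).

Lemma dpairE m (u : dmor m 1) (t : dmor m n) i :
  dfun (dpair u t) i = inord (minn N (c (dfun u i) (dfun t i))).
Proof. exact: mkdE. Qed.

Lemma dpair_comp m p (u : dmor m 1) (t : dmor m n) (s : dmor p m) :
  dcomp (dpair u t) s = dpair (dcomp u s) (dcomp t s).
Proof. by apply: dmorP => i; rewrite !(dcompE, dpairE). Qed.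

End PairMap.
Arguments dpair {n} N {c} hc {m}.

Fact mono2_initial : mono2 (fun a b => a * b.+1).
Proof. by move=> a a' b b' aa bb; rewrite leq_mul. Qed.

Fact mono2_final n : mono2 (fun a b => maxn (a * n) b).
Proof. by move=> a a' b b' aa bb; nia. Qed.

Fact mono2_split : mono2 (fun a b => 2 <= a + b).
Proof. by move=> a a' b b' aa bb; lia. Qed.

(* As [dcase], for maps that depend on arbitrary simplices [u] and [t], by cases
   on the values of these at a vertex. *)
Ltac dcase2 := apply: dmorP; let i := fresh "i" in intro i;
  rewrite ?(dcompE, dfaceE, dconstE, didE, dpairE, mkdE);
  repeat match goal with |- context [dfun ?u i] =>
    move: (dfun u i); case=> [[|[|[|[|?]]]] ?] // end;
  revert i; case=> [[|[|[|[|?]]]] ?] //;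
  apply: val_inj => /=; rewrite ?inordK //=.

Section Squares.
Variables (K : cosmos) (X D : K).
Implicit Types (alpha : hom X D 1) (s : hom X D 2) (W : hom X D 3).
Implicit Types (y : hom X (arrow D) 0) (chi : hom X (arrow D) 1).

(** By the universal property of the cotensor, [x] amounts to a map from
    [Delta 1 x Delta n] to [hom X D]; [sq x] is that map. Below, such an [x]
    with [n = 1] is pictured as a square with vertices [(a, i)], where [a] is
    the coordinate in [Delta 1] and [i] the one in [Delta n]: the arrows [a =
    0 => 1] at [i = 0] and [i = 1] are its source and target. *)
Definition sq n (x : hom X (arrow D) n) m (u : dmor m 1) (t : dmor m n) :
  hom X D m := cot_cone (arrowP D) m u ∘ act t x.

Lemma act_sq n (x : hom X (arrow D) n) m (u : dmor m 1) (t : dmor m n) p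
    (r : dmor p m) : act r (sq x u t) = sq x (dcomp u r) (dcomp t r).
Proof. by rewrite /sq scomp_act -sfun_act act_comp. Qed.

Lemma sq_act n p (r : dmor p n) (x : hom X (arrow D) n) m (u : dmor m 1)
  (t : dmor m p) : sq (act r x) u t = sq x u (dcomp r t).
Proof. by rewrite /sq act_comp. Qed.

Lemma sq_ext n (x y : hom X (arrow D) n) :
  (forall m (u : dmor m 1) (t : dmor m n), sq x u t = sq y u t) -> x = y.
Proof. exact: (cot_uniq (c0 := arrowP D)). Qed.

Lemma ev0_sq n (x : hom X (arrow D) n) :
  ev0 D *> x = sq x (dconst n 1 ord0) (did n).
Proof.
rewrite /sq act_id /ev0 /deg -sfun_act; congr (cot_cone _ _ _ ∘ _).
by apply: dmorP => i; rewrite /= dcompE !dconstE.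
Qed.

Lemma ev1_sq n (x : hom X (arrow D) n) :
  ev1 D *> x = sq x (dconst n 1 ord_max) (did n).
Proof.
rewrite /sq act_id /ev1 /deg -sfun_act; congr (cot_cone _ _ _ ∘ _).
by apply: dmorP => i; rewrite /= dcompE !dconstE.
Qed.

Definition edge y : hom X D 1 := arrow_cell D <* y.

Lemma edge_sq y : edge y = sq y (did 1) (dconst 1 0 ord0).
Proof. by []. Qed.

Section Pull.
Variables (n N : nat) (c : nat -> nat -> nat) (hc : mono2 c) (T : hom X D N).

Fact pull_subproof p m (r : dmor p m) (z : sprod (Delta 1) (Delta n) m) :
  act (dpair N hc (act r z).1 (act r z).2) T =
  act r (act (dpair N hc z.1 z.2) T).
Proof. by rewrite -act_comp dpair_comp. Qed.

Definition pull : hom X (arrow D) n :=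
  cot_lift (arrowP D) (SMap pull_subproof).

Lemma sq_pull m (u : dmor m 1) (t : dmor m n) :
  sq pull u t = act (dpair N hc u t) T.
Proof. exact: cot_beta. Qed.

End Pull.

(** A simplex of the thin slice under the vertex 0 of [T], resp. over its last
    vertex, seen in the fat slice: all the arrows of [thin_initial T] start at
    the vertex 0, [(0, i)] being sent to 0 and [(1, i)] to [i.+1]; all those of
    [thin_final T] end at the last vertex, [(0, i)] being sent to [i]. *)
Definition thin_initial n (T : hom X D n.+1) : hom X (arrow D) n :=
  pull n mono2_initial T.
Definition thin_final n (T : hom X D n.+1) : hom X (arrow D) n :=
  pull n (@mono2_final n.+1) T.

(** The two triangles on the diagonal from [(0, 0)] to [(1, 1)]: the upper one
    passes through [(1, 0)], the lower one through [(0, 1)]. *)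
Definition upper chi : hom X D 2 :=
  sq chi (dvec 2 1 [:: 0; 1; 1]) (dvec 2 1 [:: 0; 0; 1]).
Definition lower chi : hom X D 2 :=
  sq chi (dvec 2 1 [:: 0; 0; 1]) (dvec 2 1 [:: 0; 1; 1]).

Definition name alpha : hom X (arrow D) 0 := thin_initial alpha.

Fact split_sq_subproof chi p m (r : dmor p m)
    (z : sprod (Delta 1) (Delta 2) m) :
  sq chi (act r z).1 (dpair 1 mono2_split (act r z).1 (act r z).2) =
  act r (sq chi z.1 (dpair 1 mono2_split z.1 z.2)).
Proof. by rewrite act_sq dpair_comp. Qed.

(** The pullback of a square along the map of posets from [1] x [2] to [1] x [1]
    that sends the middle arrow [(0, 1) -> (1, 1)] to the diagonal. Its faces
    exhibit the square as the composite of its upper triangle, which leads from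
    its source to the diagonal, and its lower triangle. *)
Definition split_sq chi : hom X (arrow D) 2 :=
  cot_lift (arrowP D) (SMap (split_sq_subproof chi)).

Lemma sq_split chi m (u : dmor m 1) (t : dmor m 2) :
  sq (split_sq chi) u t = sq chi u (dpair 1 mono2_split u t).
Proof. exact: cot_beta. Qed.

Lemma d0_split chi : d0 (split_sq chi) = thin_final (lower chi).
Proof.
apply: sq_ext => m u t; rewrite /d0 sq_act sq_split sq_pull act_sq.
by congr sq; dcase2.
Qed.
Lemma d1_split chi : d1 (split_sq chi) = chi.
Proof.
by apply: sq_ext => m u t; rewrite /d1 sq_act sq_split; congr sq; dcase2.
Qed.
Lemma d2_split chi : d2 (split_sq chi) = thin_initial (upper chi).
Proof.
apply: sq_ext => m u t; rewrite /d2 sq_act sq_split sq_pull act_sq.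
by congr sq; dcase2.
Qed.

Ltac dthin := apply: sq_ext => m u t; rewrite sq_act !sq_pull -!act_comp;
  congr act; dcase2.

Lemma src_thin_initial s : src (thin_initial s) = name (d2 s).
Proof. by rewrite /src /d2; dthin. Qed.
Lemma tgt_thin_initial s : tgt (thin_initial s) = name (d1 s).
Proof. by rewrite /tgt /d1; dthin. Qed.
Lemma tgt_thin_final s : tgt (thin_final s) = name (d0 s).
Proof. by rewrite /tgt /d0; dthin. Qed.

Lemma d0_thin_initial W : d0 (thin_initial W) = thin_initial (face3 1 W).
Proof. by rewrite /d0 /face3; dthin. Qed.
Lemma d1_thin_initial W : d1 (thin_initial W) = thin_initial (face3 2 W).
Proof. by rewrite /d1 /face3; dthin. Qed.
Lemma d2_thin_initial W : d2 (thin_initial W) = thin_initial (face3 3 W).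
Proof. by rewrite /d2 /face3; dthin. Qed.
Lemma d0_thin_final W : d0 (thin_final W) = thin_final (face3 0 W).
Proof. by rewrite /d0 /face3; dthin. Qed.
Lemma d1_thin_final W : d1 (thin_final W) = thin_final (face3 1 W).
Proof. by rewrite /d1 /face3; dthin. Qed.
Lemma d2_thin_final W : d2 (thin_final W) = thin_final (face3 2 W).
Proof. by rewrite /d2 /face3; dthin. Qed.

Ltac dend := rewrite ?ev0_sq ?ev1_sq sq_pull /deg -?act_comp; congr act; dcase2.

Lemma ev0_thin_initial1 s : ev0 D *> thin_initial s = deg 1 (src (d2 s)).
Proof. by rewrite /src /d2; dend. Qed.
Lemma ev1_thin_initial1 s : ev1 D *> thin_initial s = d0 s.
Proof. by rewrite /d0; dend. Qed.
Lemma ev0_thin_final1 s : ev0 D *> thin_final s = d2 s.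
Proof. by rewrite /d2; dend. Qed.
Lemma ev1_thin_final1 s : ev1 D *> thin_final s = deg 1 (tgt (d0 s)).
Proof. by rewrite /tgt /d0; dend. Qed.
Lemma ev0_thin_initial2 W :
  ev0 D *> thin_initial W = deg 2 (src (d2 (face3 3 W))).
Proof. by rewrite /src /d2 /face3; dend. Qed.
Lemma ev1_thin_initial2 W : ev1 D *> thin_initial W = face3 0 W.
Proof. by rewrite /face3; dend. Qed.
Lemma ev0_thin_final2 W : ev0 D *> thin_final W = face3 3 W.
Proof. by rewrite /face3; dend. Qed.
Lemma ev1_thin_final2 W :
  ev1 D *> thin_final W = deg 2 (tgt (d0 (face3 0 W))).
Proof. by rewrite /tgt /d0 /face3; dend. Qed.

Lemma edge_name alpha : edge (name alpha) = alpha.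
Proof.
rewrite edge_sq sq_pull -[RHS]act_id; congr act; dcase2.
Qed.

Lemma name_edge y : name (edge y) = y.
Proof.
apply: sq_ext => m u t; rewrite sq_pull edge_sq act_sq; congr sq; dcase2.
Qed.

Lemma src_edge y : src (edge y) = ev0 D ∘ y.
Proof.
rewrite -[ev0 D]deg0 ev0_sq edge_sq /src act_sq; congr sq; dcase2.
Qed.
Lemma tgt_edge y : tgt (edge y) = ev1 D ∘ y.
Proof.
rewrite -[ev1 D]deg0 ev1_sq edge_sq /tgt act_sq; congr sq; dcase2.
Qed.

Lemma d2_upper chi : d2 (upper chi) = edge (src chi).
Proof. rewrite edge_sq /src sq_act /d2 act_sq; congr sq; dcase2. Qed.
Lemma d0_upper chi : d0 (upper chi) = ev1 D *> chi.
Proof. rewrite ev1_sq /d0 act_sq; congr sq; dcase2. Qed.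
Lemma d0_lower chi : d0 (lower chi) = edge (tgt chi).
Proof. rewrite edge_sq /tgt sq_act /d0 act_sq; congr sq; dcase2. Qed.
Lemma d2_lower chi : d2 (lower chi) = ev0 D *> chi.
Proof. rewrite ev0_sq /d2 act_sq; congr sq; dcase2. Qed.
Lemma d1_lower chi : d1 (lower chi) = d1 (upper chi).
Proof. rewrite /d1 !act_sq; congr sq; dcase2. Qed.

End Squares.

(** * The arrow module *)

Section FibreLemmas.
Variables (E B : sset) (p : smap E B).

Lemma fibre_qcat y :
  (forall n (k : 'I_n.+1), 0 < k < n -> has_rlp (horn_incl k) p) ->
  is_qcat (fibre p y).
Proof.
move=> H n k hk u.
pose v : smap (Delta n) B :=
  @SMap (Delta n) B (fun m _ => deg m y) (fun m n t x => esym (act_deg t y)).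
pose u' : smap (horn k) E := @SMap (horn k) E (fun m x => sval (u m x))
  (fun m n t x => congr1 sval (sfun_act u t x)).
have [m x|w [wu wv]] := H n k hk u' v; first exact: (svalP (u m x)).
have w_act m q (t : dmor m q) (x : Delta n q) :
    exist (fun z => p m z = deg m y) (w m (act t x)) (wv m (act t x)) =
    act t (exist (fun z => p q z = deg q y) (w q x) (wv q x) : fibre p y q).
  by apply: fibre_inj; rewrite /= sfun_act.
exists (@SMap (Delta n) (fibre p y) (fun m x => exist _ (w m x) (wv m x))
  w_act).
by move=> m x; apply: fibre_inj; rewrite /= wu.
Qed.

Lemma fibre_composes y (S : fibre p y 2) (f g h : fibre p y 1) :
  d2 (sval S) = sval f -> d0 (sval S) = sval g -> d1 (sval S) = sval h ->
  composes f g h.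
Proof. by move=> e2 e0 e1; exists S; split; apply: fibre_inj. Qed.

End FibreLemmas.

Section ArrowGroupoidal.
Variables (K : cosmos) (X D : K).

Lemma pr1_ends_comp : pr1 D D ∘ arrow_ends D = ev1 D.
Proof. by have := pair1 (ev1 D) (ev0 D); rewrite deg0. Qed.
Lemma pr2_ends_comp : pr2 D D ∘ arrow_ends D = ev0 D.
Proof. by have := pair2 (ev1 D) (ev0 D); rewrite deg0. Qed.

Lemma pr1_ends_post n (x : hom X (arrow D) n) :
  (pr1 D D ∘ arrow_ends D) *> x = ev1 D *> x.
Proof. by rewrite pr1_ends_comp. Qed.
Lemma pr2_ends_post n (x : hom X (arrow D) n) :
  (pr2 D D ∘ arrow_ends D) *> x = ev0 D *> x.
Proof. by rewrite pr2_ends_comp. Qed.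

Lemma pr1_ends n (x : hom X (arrow D) n) :
  pr1 D D *> (arrow_ends D *> x) = ev1 D *> x.
Proof. by rewrite scompA -deg_comp pr1_ends_comp. Qed.
Lemma pr2_ends n (x : hom X (arrow D) n) :
  pr2 D D *> (arrow_ends D *> x) = ev0 D *> x.
Proof. by rewrite scompA -deg_comp pr2_ends_comp. Qed.

Lemma ends_deg n (x : hom X (arrow D) n) (b : hom X (xprod D D) 0) :
  arrow_ends D *> x = deg n b <->
  ev1 D *> x = deg n (pr1 D D ∘ b) /\ ev0 D *> x = deg n (pr2 D D ∘ b).
Proof.
rewrite -pr1_ends -pr2_ends !deg_comp.
by split=> [->|[e1 e2]] //; apply: prod_ext.
Qed.

Lemma thin_initial_degr (a : hom X D 1) :
  thin_initial (degr a) = deg 1 (name a).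
Proof.
apply: sq_ext => m u t; rewrite sq_act !sq_pull -!act_comp; congr act; dcase2.
Qed.
Lemma thin_final_degl (a : hom X D 1) :
  thin_final (degl a) = deg 1 (name a).
Proof.
apply: sq_ext => m u t; rewrite sq_act !sq_pull -!act_comp; congr act; dcase2.
Qed.

Lemma ev0_split (chi : hom X (arrow D) 1) :
  ev0 D *> split_sq chi = degl (ev0 D *> chi).
Proof. by rewrite !ev0_sq sq_split /degl act_sq; congr sq; dcase2. Qed.
Lemma ev1_split (chi : hom X (arrow D) 1) :
  ev1 D *> split_sq chi = degr (ev1 D *> chi).
Proof. by rewrite !ev1_sq sq_split /degr act_sq; congr sq; dcase2. Qed.

Let F b := fibre (postc X (arrow_ends D)) b.

Lemma arrow_fibre_qcat b : is_qcat (F b).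
Proof. by apply: fibre_qcat; case: (isofib_hom X (isofib_arrow_ends D)). Qed.

(** In the fibre over [b] the side [d0 s] is degenerate, so [s] says that its
    two other sides [d2 s] and [d1 s] are homotopic. The filling reverses this
    homotopy. *)
Lemma thin_initial_iso b (chi : F b 1) :
  (exists s, sval chi = thin_initial s) -> is_iso chi.
Proof.
apply: (left_inverses (@arrow_fibre_qcat b)
  (P := fun f => exists s, sval f = thin_initial s)) => {}chi.
case=> s es.
have /ends_deg[] : arrow_ends D *> thin_initial s = deg 1 b.
  by rewrite -es; apply: (svalP chi).
rewrite ev1_thin_initial1 ev0_thin_initial1 => e1 /deg1_inj e0.
have m := tgt_d2 s; rewrite e1 src_deg in m.
have [|||W [W0 W2 W3]] := @fill31 _ (@hom_qcat K X D)
    (deg 2 (pr1 D D ∘ b)) (degr (d2 s)) s.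
- by rewrite d0_degr d1_deg m.
- by rewrite e1 d2_deg.
- by rewrite d2_degr.
have HW : arrow_ends D *> thin_initial W = deg 2 b.
  by apply/ends_deg; rewrite ev1_thin_initial2 ev0_thin_initial2 W0 W3 e0.
pose S : F b 2 := exist _ (thin_initial W) HW.
exists (d0 S); split; first by exists (face3 1 W); rewrite -d0_thin_initial.
apply: (fibre_composes (S := S)) => //=.
- by rewrite d2_thin_initial W3.
- rewrite d1_thin_initial W2 thin_initial_degr.
  by rewrite -src_thin_initial -es.
Qed.

(** Dual to [thin_initial_iso], except that the inner horn now yields an inverse
    on the other side. *)
Lemma thin_final_iso b (chi : F b 1) :
  (exists s, sval chi = thin_final s) -> is_iso chi.
Proof.
apply: (right_inverses (@arrow_fibre_qcat b)
  (P := fun f => exists s, sval f = thin_final s)) => {}chi.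
case=> s es.
have /ends_deg[] : arrow_ends D *> thin_final s = deg 1 b.
  by rewrite -es; apply: (svalP chi).
rewrite ev1_thin_final1 ev0_thin_final1 => /deg1_inj e1 e0.
have m := tgt_d2 s; rewrite e0 tgt_deg in m.
have [|||W [W0 W1 W3]] := @fill32 _ (@hom_qcat K X D)
    s (degl (d0 s)) (deg 2 (pr2 D D ∘ b)).
- by rewrite d0_degl.
- by rewrite e0 d0_deg.
- by rewrite d2_degl d1_deg m.
have HW : arrow_ends D *> thin_final W = deg 2 b.
  by apply/ends_deg; rewrite ev1_thin_final2 ev0_thin_final2 W0 W3 e1.
pose S : F b 2 := exist _ (thin_final W) HW.
exists (d2 S); split; first by exists (face3 2 W); rewrite -d2_thin_final.
apply: (fibre_composes (S := S)) => //=.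
- by rewrite d0_thin_final W0.
- rewrite d1_thin_final W1 thin_final_degl.
  by rewrite -tgt_thin_final -es.
Qed.

Lemma arrow_fibre_iso b (chi : F b 1) : is_iso chi.
Proof.
have /ends_deg[e1 e0] := svalP chi.
have HS : arrow_ends D *> split_sq (sval chi) = deg 2 b.
  by apply/ends_deg; rewrite ev0_split ev1_split e0 e1 degl_deg degr_deg.
pose S : F b 2 := exist _ (split_sq (sval chi)) HS.
have c : composes (d2 S) (d0 S) chi.
  by apply: (fibre_composes (S := S)) => //=; rewrite d1_split.
apply: is_iso_comp c; first exact: arrow_fibre_qcat.
- by apply: thin_initial_iso; exists (upper (sval chi)); rewrite -d2_split.
- by apply: thin_final_iso; exists (lower (sval chi)); rewrite -d0_split.
Qed.

End ArrowGroupoidal.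

Section CartesianEdges.
Variables (S T : sset) (qS : is_qcat S) (qT : is_qcat T) (P : smap S T).

Definition vertical (x : S 1) : Prop := exists c, P 1 x = deg 1 c.

Definition vertical_iso (x : S 1) : Prop :=
  vertical x /\ exists r, [/\ vertical r, composes x r (deg 1 (src x))
                            & composes r x (deg 1 (tgt x))].

Lemma vertical_src f g h : vertical f -> composes f g h ->
  homotopic (P 1 g) (P 1 h).
Proof.
case=> c ef /(smap_composes P); rewrite ef => C.
by apply/homotopicE => //; rewrite -(composes_mid C) tgt_deg.
Qed.

Lemma vertical_tgt f g h : vertical g -> composes f g h ->
  homotopic (P 1 f) (P 1 h).
Proof.
case=> c eg /(smap_composes P); rewrite eg => C.
by rewrite /homotopic (composes_mid C) src_deg.
Qed.

(** In the intended case, [S] is a fat slice of [T] and [thin] its thin slice.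
    A lifting property for thin edges extends to all edges, since any edge is
    thin up to a vertical isomorphism. *)
Section Cartesian.
Variable thin : S 1 -> Prop.
Hypothesis factor : forall chi, exists v t,
  [/\ composes v t chi, vertical_iso v & thin t].
Hypothesis lift : forall chi tau gamma, thin chi -> thin tau ->
  tgt tau = tgt chi -> composes gamma (P 1 chi) (P 1 tau) ->
  exists g, composes g chi tau /\ P 1 g = gamma.

Lemma cartesian_lift chi tau gamma : tgt tau = tgt chi ->
  composes gamma (P 1 chi) (P 1 tau) ->
  exists g, composes g chi tau /\ homotopic (P 1 g) gamma.
Proof.
move=> ett c.
have [chi1 [chi2 [cchi [v1 [r [vr chi1r rchi1]]] t2]]] := factor chi.
have [tau1 [tau2 [ctau [vt _] tt2]]] := factor tau.
have [||g2 [cg2 eg2]] := @lift chi2 tau2 gamma t2 tt2.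
- by rewrite -(composes_tgt cchi) -(composes_tgt ctau).
- apply: composes_congr c => //; first exact: homotopic_refl.
  + by apply: homotopic_sym => //; apply: vertical_src cchi.
  + by apply: homotopic_sym => //; apply: vertical_src ctau.
have [m cm] : exists m, composes tau1 g2 m.
  by apply: composes_ex => //; rewrite (composes_mid ctau) (composes_src cg2).
have tm : tgt m = tgt chi1.
  by rewrite (composes_tgt cm) (composes_mid cg2) (composes_mid cchi).
have [g cg] : exists g, composes m r g.
  by apply: composes_ex => //; rewrite tm (composes_mid chi1r).
have cgm : composes g chi1 m.
  apply/(composes_assoc qS _ cg rchi1); rewrite -tm; exact: composes_idr.
exists g; split.
  apply/(composes_assoc qS _ cgm cchi).
  by apply/(composes_assoc qS _ cm cg2).
rewrite -eg2; apply: homotopic_sym => //.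
apply: homotopic_trans (vertical_tgt vr cg) => //.
exact: vertical_src cm.
Qed.

(** Lifting an identity along [gamma] gives a one-sided inverse over an
    identity, to which the same applies. *)
Lemma cartesian_conservative gamma :
  homotopic (P 1 gamma) (deg 1 (P 0 (src gamma))) -> is_iso gamma.
Proof.
move: gamma; apply: right_inverses => // f Hf.
have e : P 0 (tgt f) = P 0 (src f).
  by rewrite -smap_tgt (homotopic_tgt Hf) tgt_deg.
have [||g [cg hg]] := @cartesian_lift f (deg 1 (tgt f)) (deg 1 (P 0 (src f))).
- by rewrite tgt_deg.
- by rewrite smap_deg e -smap_src; apply/homotopicE => //; rewrite smap_src.
exists g; split=> //.
by rewrite -(composes_src cg) src_deg e.
Qed.
End Cartesian.

Section Cocartesian.
Variable thin : S 1 -> Prop.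
Hypothesis factor : forall chi, exists t v,
  [/\ composes t v chi, vertical_iso v & thin t].
Hypothesis lift : forall chi tau gamma, thin chi -> thin tau ->
  src tau = src chi -> composes (P 1 chi) gamma (P 1 tau) ->
  exists g, composes chi g tau /\ P 1 g = gamma.

Lemma cocartesian_lift chi tau gamma : src tau = src chi ->
  composes (P 1 chi) gamma (P 1 tau) ->
  exists g, composes chi g tau /\ homotopic (P 1 g) gamma.
Proof.
move=> ess c.
have [chi1 [chi2 [cchi [v2 [r [vr chi2r rchi2]]] t1]]] := factor chi.
have [tau1 [tau2 [ctau [vt _] tt1]]] := factor tau.
have [||g1 [cg1 eg1]] := @lift chi1 tau1 gamma t1 tt1.
- by rewrite -(composes_src cchi) -(composes_src ctau).
- apply: composes_congr c => //; last first.
  + by apply: homotopic_sym => //; apply: vertical_tgt ctau.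
  + exact: homotopic_refl.
  + by apply: homotopic_sym => //; apply: vertical_tgt cchi.
have sg1 : src g1 = src chi2 by rewrite -(composes_mid cg1) (composes_mid cchi).
have [m cm] : exists m, composes r g1 m.
  by apply: composes_ex => //; rewrite sg1 (composes_mid rchi2).
have [g cg] : exists g, composes m tau2 g.
  apply: composes_ex => //.
  by rewrite (composes_tgt cm) -(composes_tgt cg1) (composes_mid ctau).
have cgm : composes chi2 m g1.
  by apply/(composes_assoc qS _ chi2r cm); rewrite -sg1; apply: composes_idl.
exists g; split.
  have c1 : composes chi m tau1 by apply/(composes_assoc qS _ cchi cgm).
  by apply/(composes_assoc qS _ c1 cg).
rewrite -eg1; apply: homotopic_sym => //.
apply: homotopic_trans (vertical_tgt vt cg) => //.
exact: vertical_src cm.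
Qed.

Lemma cocartesian_conservative gamma :
  homotopic (P 1 gamma) (deg 1 (P 0 (src gamma))) -> is_iso gamma.
Proof.
move: gamma; apply: left_inverses => // f Hf.
have e : P 0 (tgt f) = P 0 (src f).
  by rewrite -smap_tgt (homotopic_tgt Hf) tgt_deg.
have [||g [cg hg]] := @cocartesian_lift f (deg 1 (src f)) (deg 1 (P 0 (src f))).
- by rewrite src_deg.
- by move: Hf; rewrite /homotopic smap_tgt smap_deg e.
exists g; split=> //.
by rewrite -(composes_mid cg) e.
Qed.
End Cocartesian.

End CartesianEdges.

Section ArrowModule.
Variables (K : cosmos) (D : K).

Definition arrow_span : hspan D D := HSpan (isofib_arrow_ends D).

(** Both legs of the arrow span at once: [pr] is one of the projections, and [P]
    the map induced by [arrow_ends] on functor spaces of the slice over [D]. *)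
Section Leg.
Variables (X : K) (pr : hom (xprod D D) D 0) (b : hom X D 0).

Let S := fibre (postc X (pr ∘ arrow_ends D)) b.
Let T := fibre (postc X pr) b.

Variable P : smap S T.
Hypothesis PE : forall n (x : S n), sval (P n x) = arrow_ends D *> sval x.

Section FromFibre.
Variables (c : hom X (xprod D D) 0) (ec : pr ∘ c = b).

Fact from_fibre_subproof n (x : fibre (postc X (arrow_ends D)) c n) :
  (pr ∘ arrow_ends D) *> sval x = deg n b.
Proof.
have e : arrow_ends D *> sval x = deg n c by apply: (svalP x).
by rewrite deg_comp -scompA e -deg_comp ec. Qed.

Definition from_fibre : smap (fibre (postc X (arrow_ends D)) c) S.
Proof.
exists (fun n x => exist _ (sval x) (from_fibre_subproof x)).
abstract by move=> m n t x; apply: fibre_inj.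
Defined.

Lemma from_fibre_vertical x : vertical P (from_fibre 1 x).
Proof.
have cT : postc X pr 0 c = deg 0 b by rewrite /= !deg0.
exists (exist _ c cT : T 0).
apply: (fibre_inj (f := postc X pr)).
by rewrite PE; apply: (svalP x).
Qed.

End FromFibre.

(** An edge with degenerate image in [D x D] lies in a fibre of [arrow_ends],
    where it is invertible. *)
Lemma vertical_isoI (x : S 1) c :
  arrow_ends D *> sval x = deg 1 c -> vertical_iso P x.
Proof.
move=> ex.
have ec : pr ∘ c = b.
  apply: deg1_inj; rewrite deg_comp -ex scompA -deg_comp.
  exact: (svalP x).
pose x' : fibre (postc X (arrow_ends D)) c 1 := exist _ (sval x) ex.
have xx' : x = from_fibre ec 1 x' by apply: fibre_inj.
split; first by rewrite xx'; apply: from_fibre_vertical.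
have [r [xr rx]] := arrow_fibre_iso x'.
exists (from_fibre ec 1 r); rewrite xx'; split.
- exact: from_fibre_vertical.
- by have := smap_composes (from_fibre ec) xr; rewrite smap_deg -smap_src.
- by have := smap_composes (from_fibre ec) rx; rewrite smap_deg -smap_tgt.
Qed.

Lemma factorization (chi : S 1) :
  (pr ∘ arrow_ends D) *> split_sq (sval chi) = deg 2 b ->
  exists v t : S 1, [/\ composes v t chi, sval v = d2 (split_sq (sval chi))
                      & sval t = d0 (split_sq (sval chi))].
Proof.
move=> HS; pose s : S 2 := exist _ (split_sq (sval chi)) HS.
exists (d2 s), (d0 s); split=> //.
by apply: (fibre_composes (S := s)) => //=; rewrite d1_split.
Qed.

End Leg.

Section Left.
Variables (X : over D).
Let S := @hom (slice D) X (h_over_l arrow_span).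
Let T := @hom (slice D) X (prod_over_l D D).
Let P : smap S T := @postc (slice D) X _ _ (leg_over_l arrow_span).
Let b := ov_map X.

Let PE n (x : S n) : sval (P n x) = arrow_ends D *> sval x.
Proof. by []. Qed.

Let qS : is_qcat S.
Proof.
by apply: fibre_qcat; case: (isofib_hom (ov_ob X) (isofib_h_l arrow_span)).
Qed.

Let qT : is_qcat T.
Proof. by apply: fibre_qcat; case: (isofib_hom (ov_ob X) (isofib_pr1 D D)). Qed.

Let ev1S n (x : S n) : ev1 D *> sval x = deg n b.
Proof. by rewrite -pr1_ends_post; apply: (svalP x). Qed.

Let thin (x : S 1) : Prop := exists s, sval x = thin_final s.

Let factor (chi : S 1) : exists v t,
  [/\ composes v t chi, vertical_iso P v & thin t].
Proof.
have [|v [t [c ev et]]] := @factorization (ov_ob X) (pr1 D D) b chi.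
  by rewrite pr1_ends_post ev1_split ev1S degr_deg.
exists v, t; split=> //; last by exists (lower (sval chi)); rewrite et d0_split.
pose e := src (ev0 D *> sval chi).
apply: (@vertical_isoI _ (pr1 D D) b P PE v (xpair b e)).
rewrite ev; apply: prod_ext; rewrite ?pr1_ends ?pr2_ends -!deg_comp.
  have := pair1 b e; rewrite deg0 => ->.
  by rewrite postc_d2 ev1_split ev1S d2_degr.
have := pair2 b e; rewrite deg0 => ->.
by rewrite postc_d2 ev0_split d2_degl.
Qed.

(** The triangles of [chi] and [tau] and the second component of [sigma] are the
    faces 0, 1 and 3 of an inner horn; its filler is a thin 2-simplex. *)
Let lift (chi tau : S 1) (gamma : T 1) : thin chi -> thin tau ->
  tgt tau = tgt chi -> composes gamma (P 1 chi) (P 1 tau) ->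
  exists g, composes g chi tau /\ P 1 g = gamma.
Proof.
move=> [s es] [t et] ett [sigma [sg sc st]].
pose sigma0 := pr2 D D *> sval sigma.
have d0t : d0 t = d0 s.
  rewrite -[LHS]edge_name -[RHS]edge_name -!tgt_thin_final -es -et.
  by congr edge; apply: (congr1 sval ett).
have s0 : d0 sigma0 = d2 s.
  rewrite -ev0_thin_final1 -es -pr2_ends -PE -sc.
  by rewrite -postc_d0.
have s1 : d1 sigma0 = d2 t.
  rewrite -ev0_thin_final1 -et -pr2_ends -PE -st.
  by rewrite /d1 scomp_act act_deg.
have [|||W [W0 W1 W3]] := @fill32 _ (@hom_qcat K (ov_ob X) D) s t sigma0 => //.
have eb : tgt (d0 s) = b.
  by apply: deg1_inj; rewrite -ev1_thin_final1 -es.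
have HW : (pr1 D D ∘ arrow_ends D) *> thin_final W = deg 2 b.
  by rewrite pr1_ends_post ev1_thin_final2 W0 eb.
pose w : S 2 := exist _ (thin_final W) HW.
exists (d2 w); split.
  apply: (fibre_composes (S := w)) => //=.
  - by rewrite d0_thin_final W0.
  - by rewrite d1_thin_final W1.
apply: fibre_inj; rewrite PE; apply: prod_ext; rewrite ?pr1_ends ?pr2_ends.
  by rewrite ev1S; apply/esym; apply: (svalP gamma).
rewrite -sg postc_d2 /= postc_d2.
by rewrite ev0_thin_final2 W3.
Qed.

Lemma arrow_cartesian_cell (chi : S 1) :
  cartesian_cell (leg_over_l arrow_span) chi.
Proof.
split=> [tau gamma ett _ _ c|gamma es _ _ h].
  have [g [cg hg]] := cartesian_lift qS qT factor lift ett c.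
  by exists g; rewrite -(composes_src cg) (composes_mid cg).
apply: (cartesian_conservative qS qT factor lift).
by rewrite [P 0 _]postc0 es.
Qed.

Lemma arrow_cartesian_lift (e : S 0) (alpha : T 1) :
  tgt alpha = leg_over_l arrow_span ∘ e ->
  exists chi : S 1, tgt chi = e /\ P 1 chi = alpha.
Proof.
move=> ea; pose a := pr2 D D *> sval alpha.
have ea' : tgt (sval alpha) = arrow_ends D ∘ sval e := congr1 sval ea.
have m : tgt a = src (edge (sval e)).
  by rewrite postc_tgt ea' scompA pr2_ends_comp src_edge.
have [s [s2 s0]] := fill21 (@hom_qcat K (ov_ob X) D) m.
have Hs : (pr1 D D ∘ arrow_ends D) *> thin_final s = deg 1 b.
  rewrite pr1_ends_post ev1_thin_final1 s0 tgt_edge -[ev1 D]deg0 ev1S.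
  by rewrite deg0.
exists (exist _ (thin_final s) Hs : S 1); split; apply: fibre_inj.
  by rewrite [LHS]tgt_thin_final s0 name_edge.
rewrite PE /=; apply: prod_ext; rewrite ?pr1_ends ?pr2_ends.
  by rewrite -pr1_ends_post Hs; apply/esym; apply: (svalP alpha).
by rewrite ev0_thin_final1 s2.
Qed.

End Left.

Lemma arrow_cartesian : cartesian_fibration (leg_over_l arrow_span).
Proof.
split=> [X e alpha ea|X Y chi x _]; last exact: arrow_cartesian_cell.
have [chi [tchi echi]] := arrow_cartesian_lift ea.
exists chi; split=> //; last exact: arrow_cartesian_cell.
by rewrite -echi; apply: homotopic_refl.
Qed.

Section Right.
Variables (X : over D).
Let S := @hom (slice D) X (h_over_r arrow_span).
Let T := @hom (slice D) X (prod_over_r D D).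
Let P : smap S T := @postc (slice D) X _ _ (leg_over_r arrow_span).
Let b := ov_map X.

Let PE n (x : S n) : sval (P n x) = arrow_ends D *> sval x.
Proof. by []. Qed.

Let qS : is_qcat S.
Proof.
by apply: fibre_qcat; case: (isofib_hom (ov_ob X) (isofib_h_r arrow_span)).
Qed.

Let qT : is_qcat T.
Proof. by apply: fibre_qcat; case: (isofib_hom (ov_ob X) (isofib_pr2 D D)). Qed.

Let ev0S n (x : S n) : ev0 D *> sval x = deg n b.
Proof. by rewrite -pr2_ends_post; apply: (svalP x). Qed.

Let thin (x : S 1) : Prop := exists s, sval x = thin_initial s.

Let factor (chi : S 1) : exists t v,
  [/\ composes t v chi, vertical_iso P v & thin t].
Proof.
have [|t [v [c et ev]]] := @factorization (ov_ob X) (pr2 D D) b chi.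
  by rewrite pr2_ends_post ev0_split ev0S degl_deg.
exists t, v; split=> //; last by exists (upper (sval chi)); rewrite et d2_split.
pose e := tgt (ev1 D *> sval chi).
apply: (@vertical_isoI _ (pr2 D D) b P PE v (xpair e b)).
rewrite ev; apply: prod_ext; rewrite ?pr1_ends ?pr2_ends -!deg_comp.
  have := pair1 e b; rewrite deg0 => ->.
  by rewrite postc_d0 ev1_split d0_degr.
have := pair2 e b; rewrite deg0 => ->.
by rewrite postc_d0 ev0_split ev0S d0_degl.
Qed.

(** As for the left leg, with the first component of [sigma] as face 0 of the
    inner horn, and the triangles of [tau] and [chi] as faces 2 and 3. *)
Let lift (chi tau : S 1) (gamma : T 1) : thin chi -> thin tau ->
  src tau = src chi -> composes (P 1 chi) gamma (P 1 tau) ->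
  exists g, composes chi g tau /\ P 1 g = gamma.
Proof.
move=> [s es] [t et] ess [sigma [sc sg st]].
pose sigma1 := pr1 D D *> sval sigma.
have d2t : d2 t = d2 s.
  rewrite -[LHS]edge_name -[RHS]edge_name -!src_thin_initial -es -et.
  by congr edge; apply: (congr1 sval ess).
have s2 : d2 sigma1 = d0 s.
  by rewrite -ev1_thin_initial1 -es -pr1_ends -PE -sc -postc_d2.
have s1 : d1 sigma1 = d0 t.
  rewrite -ev1_thin_initial1 -et -pr1_ends -PE -st.
  by rewrite /d1 scomp_act act_deg.
have [|||W [W0 W2 W3]] := @fill31 _ (@hom_qcat K (ov_ob X) D) sigma1 t s => //.
have eb : src (d2 s) = b.
  by apply: deg1_inj; rewrite -ev0_thin_initial1 -es.
have HW : (pr2 D D ∘ arrow_ends D) *> thin_initial W = deg 2 b.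
  by rewrite pr2_ends_post ev0_thin_initial2 W3 eb.
pose w : S 2 := exist _ (thin_initial W) HW.
exists (d0 w); split.
  apply: (fibre_composes (S := w)) => //=.
  - by rewrite d2_thin_initial W3.
  - by rewrite d1_thin_initial W2.
apply: fibre_inj; rewrite PE; apply: prod_ext; rewrite ?pr1_ends ?pr2_ends.
  by rewrite -sg postc_d0 /= postc_d0 ev1_thin_initial2 W0.
by rewrite ev0S; apply/esym; apply: (svalP gamma).
Qed.

Lemma arrow_cocartesian_cell (chi : S 1) :
  cocartesian_cell (leg_over_r arrow_span) chi.
Proof.
split=> [tau gamma ess _ _ c|gamma es _ _ h].
  have [g [cg hg]] := cocartesian_lift qS qT factor lift ess c.
  by exists g; rewrite -(composes_mid cg) (composes_tgt cg).
apply: (cocartesian_conservative qS qT factor lift).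
by rewrite [P 0 _]postc0 es.
Qed.

Lemma arrow_cocartesian_lift (e : S 0) (alpha : T 1) :
  src alpha = leg_over_r arrow_span ∘ e ->
  exists chi : S 1, src chi = e /\ P 1 chi = alpha.
Proof.
move=> ea; pose a := pr1 D D *> sval alpha.
have ea' : src (sval alpha) = arrow_ends D ∘ sval e := congr1 sval ea.
have m : tgt (edge (sval e)) = src a.
  by rewrite postc_src ea' scompA pr1_ends_comp tgt_edge.
have [s [s2 s0]] := fill21 (@hom_qcat K (ov_ob X) D) m.
have Hs : (pr2 D D ∘ arrow_ends D) *> thin_initial s = deg 1 b.
  rewrite pr2_ends_post ev0_thin_initial1 s2 src_edge -[ev0 D]deg0 ev0S.
  by rewrite deg0.
exists (exist _ (thin_initial s) Hs : S 1); split; apply: fibre_inj.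
  by rewrite [LHS]src_thin_initial s2 name_edge.
rewrite PE /=; apply: prod_ext; rewrite ?pr1_ends ?pr2_ends.
  by rewrite ev1_thin_initial1 s0.
by rewrite -pr2_ends_post Hs; apply/esym; apply: (svalP alpha).
Qed.

End Right.

Lemma arrow_cocartesian : cocartesian_fibration (leg_over_r arrow_span).
Proof.
split=> [X e alpha ea|X Y chi x _]; last exact: arrow_cocartesian_cell.
have [chi [schi echi]] := arrow_cocartesian_lift ea.
exists chi; split=> //; last exact: arrow_cocartesian_cell.
by rewrite -echi; apply: homotopic_refl.
Qed.

Lemma arrow_module : is_module arrow_span.
Proof.
split; [exact: arrow_cartesian | exact: arrow_cocartesian |].
move=> X chi; exact: arrow_fibre_iso.
Qed.

End ArrowModule.

(** * Cells into the arrow module *)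

Section ArrowCells.
Variables (K : cosmos) (X D : K) (b : hom X (xprod D D) 0).

(** The triangles of a square with degenerate ends are homotopies from its
    source and its target to its diagonal; conversely a homotopy is a thin
    square with degenerate ends. *)
Lemma isomorphic_edge (y z : fibre (postc X (arrow_ends D)) b 0) :
  isomorphic y z <-> homotopic (edge (sval y)) (edge (sval z)).
Proof.
have qX := @hom_qcat K X D.
split=> [[e [ey ez _]]|[s [s2 s0 s1]]].
  have /ends_deg[e1 e0] := svalP e.
  pose d := d1 (upper (sval e)).
  have u : composes (edge (sval y)) (deg 1 (pr1 D D ∘ b)) d.
    exists (upper (sval e)); split=> //; last by rewrite d0_upper e1.
    by rewrite d2_upper -ey.
  have l : composes (deg 1 (pr2 D D ∘ b)) (edge (sval z)) d.
    exists (lower (sval e)); rewrite /d d1_lower d2_lower e0 d0_lower -ez.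
    by split.
  apply: (@homotopic_trans _ qX _ d).
    by rewrite /homotopic (composes_mid u) src_deg.
  apply: homotopic_sym => //; apply/homotopicE => //.
  by rewrite -(composes_mid l) tgt_deg.
have /ends_deg[y1 y0] := svalP y.
have Hs : arrow_ends D *> thin_initial s = deg 1 b.
  apply/ends_deg; rewrite ev1_thin_initial1 ev0_thin_initial1 s0 s2.
  by rewrite src_edge tgt_edge -[ev1 D]deg0 -[ev0 D]deg0 y1 y0 !deg0.
exists (exist _ (thin_initial s) Hs); split; last exact: arrow_fibre_iso.
- by apply: fibre_inj; rewrite [LHS]src_thin_initial s2 name_edge.
- by apply: fibre_inj; rewrite [LHS]tgt_thin_initial s1 name_edge.
Qed.

End ArrowCells.

Lemma edge_prec (K : cosmos) (X Y D : K) (v : hom X Y 0)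
    (y : hom Y (arrow D) 0) :
  edge (y ∘ v) = edge y <* v.
Proof. by rewrite /edge deg_comp scompA. Qed.

Section Products.
Variable K : cosmos.

Lemma pr1_pair (X A B : K) (a : hom X A 0) (b : hom X B 0) :
  pr1 A B ∘ xpair a b = a.
Proof. by have := pair1 a b; rewrite deg0. Qed.

Lemma pr2_pair (X A B : K) (a : hom X A 0) (b : hom X B 0) :
  pr2 A B ∘ xpair a b = b.
Proof. by have := pair2 a b; rewrite deg0. Qed.

Lemma prod_ext0 (X A B : K) (x y : hom X (xprod A B) 0) :
  pr1 A B ∘ x = pr1 A B ∘ y -> pr2 A B ∘ x = pr2 A B ∘ y -> x = y.
Proof. by move=> e1 e2; apply: prod_ext; rewrite !deg0. Qed.

Lemma prod_map_pair (X A B C D : K) (f : hom A C 0) (g : hom B D 0)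
    (a : hom X A 0) (b : hom X B 0) :
  prod_map f g ∘ xpair a b = xpair (f ∘ a) (g ∘ b).
Proof.
by apply: prod_ext0;
  rewrite scompA !(pr1_pair, pr2_pair) -scompA ?(pr1_pair, pr2_pair).
Qed.

Lemma xpair_comp (X Y A B : K) n (a : hom Y A n) (b : hom Y B n)
  (z : hom X Y n) : xpair a b ∘ z = xpair (a ∘ z) (b ∘ z).
Proof. by apply: prod_ext; rewrite scompA !(pair1, pair2). Qed.

Lemma xpair_act (X A B : K) m n (t : dmor m n) (a : hom X A n) (b : hom X B n) :
  act t (xpair a b) = xpair (act t a) (act t b).
Proof.
by apply: prod_ext; rewrite !(pair1, pair2) -(act_deg t) -scomp_act
  !(pair1, pair2).
Qed.

Lemma xpair_deg (X A B : K) n (a : hom X A 0) (b : hom X B 0) :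
  xpair (deg n a) (deg n b) = deg n (xpair a b).
Proof. by rewrite /deg xpair_act. Qed.

Definition swap (A B : K) : hom (xprod A B) (xprod B A) 0 :=
  xpair (pr2 A B) (pr1 A B).

Lemma swapK (A B : K) : swap B A ∘ swap A B = idm (xprod A B).
Proof.
by rewrite xpair_comp pr1_pair pr2_pair; apply: prod_ext0;
  rewrite ?(pr1_pair, pr2_pair) scomp_id0r.
Qed.

End Products.

Section CommaLift.
Variables (K : cosmos) (A B C : K) (f : hom B A 0) (g : hom C A 0).

Lemma name_ends (X : K) (a : hom X A 1) :
  arrow_ends A ∘ name a = xpair (tgt a) (src a).
Proof.
have e1 := pr1_ends (name a); have e2 := pr2_ends (name a).
move: e1 e2; rewrite !deg0 -tgt_edge -src_edge edge_name => e1 e2.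
by apply: prod_ext; rewrite ?pair1 ?pair2 ?deg0.
Qed.

Lemma comma_src : src (comma_cell f g) = f ∘ comma_p0 f g.
Proof.
rewrite [comma_cell f g]/(edge (pb_snd (commaP f g))) src_edge.
rewrite -pr2_ends_comp -scompA -pb_eq scompA pr2_pair.
by rewrite -scompA.
Qed.

Lemma comma_tgt : tgt (comma_cell f g) = g ∘ comma_p1 f g.
Proof.
rewrite [comma_cell f g]/(edge (pb_snd (commaP f g))) tgt_edge.
rewrite -pr1_ends_comp -scompA -pb_eq scompA pr1_pair.
by rewrite -scompA.
Qed.

Lemma comma_lift (X : K) (b : hom X B 0) (c : hom X C 0) (a : hom X A 1) :
  src a = f ∘ b -> tgt a = g ∘ c ->
  exists u, [/\ comma_p1 f g ∘ u = c, comma_p0 f g ∘ u = b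
              & comma_cell f g <* u = a].
Proof.
move=> sa ta.
have e : prod_map g f *> xpair c b = arrow_ends A *> name a.
  by rewrite !deg0 prod_map_pair name_ends sa ta.
exists (pb_lift (commaP f g) e).
have := pb_liftl (commaP f g) e; have := pb_liftr (commaP f g) e.
rewrite !deg0 => e2 e1.
split; rewrite ?/comma_p1 ?/comma_p0 ?/h_l ?/h_r ?/comma_cell.
- by rewrite -scompA [h_leg _]/(pb_fst (commaP f g)) e1 pr1_pair.
- by rewrite -scompA [h_leg _]/(pb_fst (commaP f g)) e1 pr2_pair.
- by rewrite prec_comp e2 -/(edge _) edge_name.
Qed.

End CommaLift.

(** * Restriction along an initial functor *)

Section Initial.
Variables (K : cosmos) (A B : K) (k : hom A B 0).

(** [s] is the horizontal source of the cell that is a composite by initiality,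
    and [E] its target, which is [B] itself up to isomorphism: the left leg of
    [T'] is invertible by [T'_section]. *)
Let E : hspan B (pt K) := comma (idm (pt K)) (to_pt B).
Let s : hseq B (pt K) := exact_source (to_pt A) k.
Let T' := comp_span E (id_span (pt K)).

Lemma arrow_pt_eq X n (x y : hom X (arrow (pt K)) n) : x = y.
Proof. by apply: sq_ext => *; apply: to_pt_eq. Qed.

Let T'_eq X n (x y : hom X (sp_ob T') n) :
  sp_l T' *> x = sp_l T' *> y -> x = y.
Proof.
move=> e; apply: (@pb_uniq _ _ _ _ _ _ (compP E (id_span (pt K)))).
  exact: to_pt_eq.
apply: (@pb_uniq _ _ _ _ _ _ (commaP (idm (pt K)) (to_pt B)));
  last exact: arrow_pt_eq.
apply: prod_ext; last exact: to_pt_eq.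
by move: e; rewrite /= !deg_comp -!scompA.
Qed.

Let T'_section : exists j : hom B (sp_ob T') 0,
  sp_l T' ∘ j = idm B /\ j ∘ sp_l T' = idm (sp_ob T').
Proof.
have [||u [u1 _ _]] := @comma_lift K _ _ _ (idm (pt K)) (to_pt B) B (to_pt B)
  (idm B) (deg 1 (to_pt B)); try exact: to_pt_eq.
have e : sp_l (id_span (pt K)) *> to_pt B = h_r E *> u by exact: to_pt_eq.
have := pb_liftr (compP E (id_span (pt K))) e.
move: (pb_lift _ e) => j; rewrite deg0 => ej.
have lj : sp_l T' ∘ j = idm B by rewrite /= -scompA ej.
exists j; split=> //; apply: T'_eq.
by rewrite deg0 scompA lj scomp_id0l scomp_id0r.
Qed.

Hypothesis k_initial : initial k.
Variables (D : K) (c : hom (pt K) D 0) (g : hom B D 0).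

(** A 2-cell from the constant functor at [c] to [g v]. *)
Let cone X (v : hom X B 0) (a : hom X D 1) : Prop :=
  src a = c ∘ to_pt X /\ tgt a = g ∘ v.

Let c_pt X (u v : hom X (pt K) 0) : c ∘ u = c ∘ v.
Proof. by rewrite (to_pt_eq u v). Qed.

Let cell_edge (S : span B (pt K)) (y : cells S (arrow_span D) g c 0) :
  cone (sp_l S) (edge (sval y)).
Proof.
case: y => z /= ez; have /ends_deg[e1 e0] : arrow_ends D *> z = _ := ez.
rewrite !deg0 pr1_pair in e1; rewrite !deg0 pr2_pair in e0.
by split; rewrite ?src_edge ?tgt_edge ?e0 ?e1 //; apply: c_pt.
Qed.

Let edge_cell (S : span B (pt K)) a : cone (sp_l S) a ->
  exists y : cells S (arrow_span D) g c 0, edge (sval y) = a.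
Proof.
move=> [sa ta].
have e : postc (sp_ob S) (arrow_ends D) 0 (name a) =
    deg 0 (xpair (g ∘ sp_l S) (c ∘ sp_r S)).
  by rewrite /= !deg0 name_ends sa ta (c_pt _ (sp_r S)).
exists (exist _ (name a) e : cells S (arrow_span D) g c 0).
exact: edge_name.
Qed.

Let t := sp_l (total s).

(** The universal property of the composite cell, with no modules on either side
    of it, in terms of cones. *)
Let initial_bijection :
  (forall chi, cone t chi ->
     exists2 a, cone (idm B) a & homotopic (a <* t) chi) /\
  (forall a a', cone (idm B) a -> cone (idm B) a' ->
     homotopic (a <* t) (a' <* t) -> homotopic a a').
Proof.
have [_ _ [_ [nu [_ _ comp]]]] := k_initial.
pose w : hom (sp_ob (total s)) (sp_ob T') 0 :=
  whisker_r_fun nu (id_span (pt K)).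
pose F S := cells S (arrow_span D) g c.
have {}comp : forall y : F (total s) 0, exists y' : F T' 0,
    let factors (z : F T' 0) := exists z' : F (total s) 0,
      sval z' = sval z ∘ w /\ isomorphic z' y in
    factors y' /\ forall z, factors z -> isomorphic z y'.
  exact: (comp B (hnil B) (pt K) (hnil (pt K)) I I D D (arrow_span D) g c
    (arrow_module D)).
have [j [lj jl]] := T'_section.
have lw : sp_l T' ∘ w = t by exact: whisker_r_l.
have jt : j ∘ t = w by rewrite -lw scompA jl scomp_id0l.
have qT : is_qcat (hom (sp_ob (total s)) D) by exact: hom_qcat.
have q' : is_qcat (hom (sp_ob T') D) by exact: hom_qcat.
(* [E] being isomorphic to [B], whiskering with the composite cell is
   restriction along [t]. *)
split=> [chi /(edge_cell (S := total s))[y ey]|a a' ha ha' h].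
  have [y' [[y'' [e'' /isomorphic_edge iso]] _]] := comp y.
  have [sy ty] := cell_edge y'.
  exists (edge (sval y') <* j).
    rewrite /cone prec_src prec_tgt sy ty -(scompA g) lj -(scompA c).
    by split=> //; apply: c_pt.
  by rewrite -ey prec_comp jt -edge_prec -e''.
have extend x : cone (idm B) x -> exists y : cells T' (arrow_span D) g c 0,
    edge (sval y) = x <* sp_l T'.
  move=> [sx tx]; apply: edge_cell; rewrite /cone prec_src prec_tgt sx tx.
  by rewrite -(scompA g) scomp_id0l -(scompA c); split=> //; apply: c_pt.
have [[y ey] [y' ey']] := (extend a ha, extend a' ha').
have [chi echi] : exists chi : cells (total s) (arrow_span D) g c 0,
    edge (sval chi) = a <* t.
  have [sa ta] := ha; apply: edge_cell; rewrite /cone prec_src prec_tgt sa ta.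
  by rewrite -(scompA g) scomp_id0l -(scompA c); split=> //; apply: c_pt.
have [chi' [_ uniq]] := comp chi.
have factors (z : F T' 0) (x : hom B D 1) : edge (sval z) = x <* sp_l T' ->
    homotopic (x <* t) (a <* t) -> cone (idm B) x -> isomorphic z chi'.
  move=> ez hx [sx tx]; apply: uniq.
  have [|z' ez'] := @edge_cell (total s) (x <* t).
    rewrite /cone prec_src prec_tgt sx tx.
    by rewrite -(scompA g) scomp_id0l -(scompA c); split=> //; apply: c_pt.
  exists z'; split; last by apply/isomorphic_edge; rewrite ez' echi.
  by rewrite -[LHS]name_edge -[RHS]name_edge ez' edge_prec ez prec_comp lw.
have /isomorphic_edge h1 := factors _ _ ey (homotopic_refl _) ha.
have /isomorphic_edge h2 := factors _ _ ey' (homotopic_sym qT h) ha'.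
have := homotopic_trans q' h1 (homotopic_sym q' h2).
rewrite ey ey' => /(smap_homotopic (prec D j)).
by rewrite /= !prec_comp lj !scomp_idr.
Qed.

Let T := sp_ob (total s).
Let phi : hom T B 1 := comma_cell k (idm B) <* exact_pr_l (to_pt A) k.
Let q : hom T A 0 := comma_p0 k (idm B) ∘ exact_pr_l (to_pt A) k.

Let src_phi : src phi = k ∘ q.
Proof. by rewrite prec_src comma_src -scompA. Qed.
Let tgt_phi : tgt phi = t.
Proof. by rewrite prec_tgt comma_tgt scomp_id0l. Qed.

(** The functor to the comma that picks out the identities of the [k a]. *)
Let diagonal : exists i : hom A T 0,
  [/\ t ∘ i = k, q ∘ i = idm A & phi <* i = deg 1 k].
Proof.
have [||u [u1 u0 ucell]] := @comma_lift K _ _ _ k (idm B) A (idm A) k (deg 1 k).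
- by rewrite src_deg scomp_id0r.
- by rewrite tgt_deg scomp_id0l.
have [||v [v1 _ _]] := @comma_lift K _ _ _ (idm (pt K)) (to_pt A) A (to_pt A)
  (idm A) (deg 1 (to_pt A)); try exact: to_pt_eq.
pose R := comma_r (to_pt A).
have ew : sp_l (id_span (pt K)) *> to_pt A = h_r R *> v by exact: to_pt_eq.
have := pb_liftr (compP R (id_span (pt K))) ew.
move: (pb_lift _ ew) => w; rewrite deg0 => w2.
pose S := comp_span R (id_span (pt K)).
have ei : sp_l S *> w = h_r (comma_l k) *> u.
  by rewrite !deg0 -[RHS]/(comma_p0 k (idm B) ∘ u) u0 /= -scompA w2 v1.
have := pb_liftr (compP (comma_l k) S) ei.
move: (pb_lift _ ei) => i; rewrite deg0 => i2; exists i.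
split; rewrite /t /q /phi ?prec_comp /= -?scompA ?i2.
- by rewrite scompA.
- by rewrite scompA.
- by rewrite -prec_comp.
Qed.

(** A cone on [A] extends by [phi] to the comma, whence it descends to [B] by
    initiality; restricting it along [diagonal] gives back the given cone. *)
Lemma initial_restriction :
  (forall b : hom A D 1, src b = c ∘ to_pt A -> tgt b = g ∘ k ->
     exists a : hom B D 1,
       [/\ src a = c ∘ to_pt B, tgt a = g & homotopic (a <* k) b]) /\
  (forall a a' : hom B D 1,
     src a = c ∘ to_pt B -> tgt a = g ->
     src a' = c ∘ to_pt B -> tgt a' = g ->
     homotopic (a <* k) (a' <* k) -> homotopic a a').
Proof.
have qT : is_qcat (hom T D) by exact: hom_qcat.
have qA : is_qcat (hom A D) by exact: hom_qcat.
have [extend unique] := initial_bijection.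
split=> [b sb tb|a a' sa ta sa' ta' h].
  have [i [ti qi phii]] := diagonal.
  have [chi cchi] : exists chi, composes (b <* q) (g *> phi) chi.
    apply: composes_ex => //.
    by rewrite prec_tgt postc_src src_phi tb scompA.
  have [|a [sa ta] h] := extend chi.
    rewrite /cone (composes_src cchi) (composes_tgt cchi) prec_src sb.
    by rewrite postc_tgt tgt_phi -scompA; split=> //; apply: c_pt.
  exists a; split=> //; first by rewrite ta scomp_id0r.
  have := smap_homotopic (prec D i) h; rewrite /= prec_comp ti.
  move/homotopic_trans; apply=> //; apply: homotopic_sym => //.
  have := smap_composes (prec D i) cchi; rewrite /= prec_comp qi scomp_idr.
  rewrite -scompA phii -deg_comp /homotopic => C.
  by have := composes_mid C; rewrite src_deg => ->.
(* The summit being constant, interchange with [phi] expresses [x <* t] through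
   the restriction of [x] to [A]. *)
have nat x : src x = c ∘ to_pt B -> tgt x = g ->
    homotopic (x <* t) (x ∘ phi) /\
    composes (x <* k <* q) (g *> phi) (x ∘ phi).
  move=> sx tx; split; last first.
    by have := interchange_r x phi; rewrite src_phi tx prec_comp.
  have := interchange_l x phi; rewrite tgt_phi sx.
  have -> : (c ∘ to_pt B) *> phi = deg 1 (c ∘ to_pt T).
    rewrite deg_comp -scompA (to_pt_eq (to_pt B *> phi) (deg 1 (to_pt T))).
    by rewrite deg_comp.
  move=> C; apply/homotopicE => //.
  by rewrite -(composes_mid C) tgt_deg.
have [[h1 c1] [h2 c2]] := (nat a sa ta, nat a' sa' ta').
apply: unique; rewrite /cone ?scomp_id0r //.
apply: homotopic_trans h1 _ => //.
apply: homotopic_trans (homotopic_sym qT h2) => //.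
apply/(composes_homotopic qT _ c1).
apply: composes_congr c2 => //; try exact: homotopic_refl.
by apply: homotopic_sym => //; apply: (smap_homotopic (prec D q) h).
Qed.

End Initial.

(** * Limit cones as 2-cells on products *)

Section Transposition.
Variables (K : cosmos) (cc : cartesian_closed K) (B C : K).

Definition uncurry (X : K) : smap (hom X (expo cc B C)) (hom (xprod X B) C).
Proof.
exists (fun n x => ev cc B C *> xpair (x <* pr1 X B) (deg n (pr2 X B))).
abstract by move=> m n t x; rewrite scomp_act xpair_act scomp_act !act_deg.
Defined.

Lemma uncurry_inj (X : K) n (x y : hom X (expo cc B C) n) :
  uncurry X n x = uncurry X n y -> x = y.
Proof. exact: curry_uniq. Qed.

Lemma curryK (X : K) n (x : hom (xprod X B) C n) : uncurry X n (curry cc x) = x.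
Proof. exact: curry_beta. Qed.

Lemma uncurryK (X : K) n (x : hom X (expo cc B C) n) :
  curry cc (uncurry X n x) = x.
Proof. by apply: uncurry_inj; rewrite curryK. Qed.

Definition curry_map (X : K) : smap (hom (xprod X B) C) (hom X (expo cc B C)).
Proof.
exists (fun n x => curry cc x).
abstract by move=> m n t x; apply: uncurry_inj; rewrite sfun_act !curryK.
Defined.

Lemma uncurry_comp (X Y : K) n (y : hom Y (expo cc B C) n) (z : hom X Y n) :
  uncurry X n (y ∘ z) =
  uncurry Y n y ∘ xpair (z <* pr1 X B) (deg n (pr2 X B)).
Proof.
rewrite /= -[RHS]scompA xpair_comp -!scompA pair1; congr (_ ∘ xpair _ _).
exact: (esym (pair2 _ _)).
Qed.

Lemma uncurry_const (X : K) n (z : hom X C n) :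
  uncurry X n (const_diag cc B C *> z) = z <* pr1 X B.
Proof. by rewrite uncurry_comp smap_deg curryK pair1. Qed.

Lemma uncurry_transpose (X : K) n (x : hom B C n) (p : hom X (pt K) 0) :
  uncurry X n (transpose cc x <* p) = x <* pr2 X B.
Proof. by rewrite uncurry_comp curryK -scompA pair2. Qed.

(** A 2-cell with values in [C^B] is a 2-cell on a product with [B]; under this
    transposition the constant diagram functor becomes the first projection. *)
Lemma is_limitE (f : hom B C 0) (l : hom (pt K) C 0) (nu : hom B C 1) :
  is_limit cc f l nu <->
  [/\ src nu = l ∘ to_pt B, tgt nu = f &
   forall X (q : hom X C 0) (chi : hom (xprod X B) C 1),
     src chi = q ∘ pr1 X B -> tgt chi = f ∘ pr2 X B ->
     let lifts (zeta : hom X C 1) :=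
       [/\ src zeta = q, tgt zeta = l ∘ to_pt X
         & composes (zeta <* pr1 X B) (nu <* pr2 X B) chi] in
     exists zeta, lifts zeta /\
       forall zeta', lifts zeta' -> homotopic zeta' zeta].
Proof.
have const0 X (q : hom X C 0) :
    uncurry X 0 (const_diag cc B C ∘ q) = q ∘ pr1 X B.
  by rewrite -[const_diag _ _ _]deg0 uncurry_const deg0.
have transpose0 X (p : hom X (pt K) 0) :
    uncurry X 0 (transpose cc f ∘ p) = f ∘ pr2 X B.
  by rewrite -[p]deg0 uncurry_transpose deg0.
have liftE X (p : hom X (pt K) 0) (zeta : hom X C 1) chi :
    composes (const_diag cc B C *> zeta) (transpose cc nu <* p) chi <->
    composes (zeta <* pr1 X B) (nu <* pr2 X B) (uncurry X 1 chi).
  rewrite -uncurry_const -(uncurry_transpose nu p).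
  split=> [/(smap_composes (uncurry X))|/(smap_composes (curry_map X))] //.
  by rewrite /curry_map [X in composes X _ _]uncurryK
    [X in composes _ X _]uncurryK [X in composes _ _ X]uncurryK.
split=> [[sn tn [_ _ H]]|[sn tn H]]; split=> //.
  move=> X q chi sc tc.
  have [||zeta [[sz tz cz] uniq]] := H X (to_pt X) q (curry cc chi).
  - by apply: uncurry_inj; rewrite -smap_src curryK sc const0.
  - by apply: uncurry_inj; rewrite -smap_tgt curryK tc transpose0.
  exists zeta; split.
    by split=> //; move/liftE: cz; rewrite curryK; apply.
  move=> z [sz' tz' cz']; apply: uniq; split=> //; apply/liftE => //.
  by rewrite curryK.
split.
- apply: uncurry_inj; rewrite -smap_src const0 curryK prec_src sn -!scompA.
  by rewrite (to_pt_eq (to_pt B ∘ _) (pr1 _ B)).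
- apply: uncurry_inj; rewrite -smap_tgt [RHS]curryK curryK prec_tgt tn.
  by rewrite deg0.
move=> X p q chi sc tc.
have [||zeta [[sz tz cz] uniq]] := H X q (uncurry X 1 chi).
- by rewrite smap_src sc const0.
- by rewrite smap_tgt tc transpose0.
have lp : l ∘ p = l ∘ to_pt X by rewrite (to_pt_eq p (to_pt X)).
exists zeta; split; first by split; rewrite ?lp //; apply/liftE.
move=> z [sz' tz' /liftE cz'].
by apply: uniq; split; rewrite -?lp //; apply: cz'.
Qed.

End Transposition.

(** * Restriction of cones with parameters *)

Section ProductRestriction.
Variables (K : cosmos) (cc : cartesian_closed K) (A B C : K) (k : hom A B 0).
Hypothesis k_initial : initial k.
Variables (X : K) (q : hom X C 0) (f : hom B C 0).

(** Transposing the parameter [X] turns a 2-cell with source [q pr1] on [X x Z]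
    into one on [Z] whose source is constant at the point of [C^X] named by [q]
    ([flip_cone]). *)
Let flip (Z : K) : smap (hom (xprod X Z) C) (hom Z (expo cc X C)) :=
  smap_comp (curry_map cc X C Z) (prec C (swap Z X)).
Let unflip (Z : K) : smap (hom Z (expo cc X C)) (hom (xprod X Z) C) :=
  smap_comp (prec C (swap X Z)) (uncurry cc X C Z).

Let flipK (Z : K) n (x : hom (xprod X Z) C n) : unflip Z n (flip Z n x) = x.
Proof. by rewrite /= [X in X <* _]curryK prec_comp swapK scomp_idr. Qed.

Let unflipK (Z : K) n (x : hom Z (expo cc X C) n) : flip Z n (unflip Z n x) = x.
Proof. by rewrite /= prec_comp swapK scomp_idr; apply: uncurryK. Qed.

Let Xk : hom (xprod X A) (xprod X B) 0 := prod_map (idm X) k.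

Let flip_nat n (x : hom (xprod X B) C n) :
  flip A n (x <* Xk) = flip B n x <* k.
Proof.
apply: uncurry_inj; rewrite uncurry_comp [LHS]curryK [in RHS]curryK.
rewrite /= prec_comp -scompA; congr (_ ∘ _).
rewrite -(deg_comp n k) xpair_deg -(deg_comp n (swap B X)); congr deg.
rewrite /Xk /swap prod_map_pair scomp_id0l xpair_comp !(pr1_pair, pr2_pair).
by [].
Qed.

Let flip_cone Z :
  flip Z 0 (q ∘ pr1 X Z) = curry cc (q ∘ pr2 (pt K) X) ∘ to_pt Z.
Proof.
apply: uncurry_inj; rewrite -[to_pt Z]deg0 uncurry_comp [LHS]curryK curryK /=.
rewrite !deg0 -!scompA pr1_pair; congr (_ ∘ _).
by have := pair2 (to_pt Z ∘ pr1 Z X) (pr2 Z X); rewrite deg0 => ->.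
Qed.

Let Xk1 : pr1 X B ∘ Xk = pr1 X A.
Proof. by rewrite pr1_pair scomp_id0l. Qed.
Let Xk2 : pr2 X B ∘ Xk = k ∘ pr2 X A.
Proof. by rewrite pr2_pair. Qed.

(** The case of generalised elements [q] follows from that of points of [C^X]. *)
Lemma product_restriction :
  (forall b : hom (xprod X A) C 1,
     src b = q ∘ pr1 X A -> tgt b = f ∘ k ∘ pr2 X A ->
     exists a : hom (xprod X B) C 1,
       [/\ src a = q ∘ pr1 X B, tgt a = f ∘ pr2 X B
         & homotopic (a <* prod_map (idm X) k) b]) /\
  (forall a a' : hom (xprod X B) C 1,
     src a = q ∘ pr1 X B -> tgt a = f ∘ pr2 X B ->
     src a' = q ∘ pr1 X B -> tgt a' = f ∘ pr2 X B ->
     homotopic (a <* prod_map (idm X) k) (a' <* prod_map (idm X) k) ->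
     homotopic a a').
Proof.
have [ex uniq] := initial_restriction k_initial
  (curry cc (q ∘ pr2 (pt K) X)) (flip B 0 (f ∘ pr2 X B)).
have gk : flip A 0 (f ∘ k ∘ pr2 X A) = flip B 0 (f ∘ pr2 X B) ∘ k.
  rewrite -[k in RHS]deg0 -flip_nat; congr (flip A 0 _).
  by rewrite deg0 -!scompA Xk2.
split=> [b sb tb|a a' sa ta sa' ta' h].
  have [||a [sa ta h]] := ex (flip A 1 b).
  - by rewrite smap_src sb flip_cone.
  - by rewrite smap_tgt tb gk.
  exists (unflip B 1 a); split.
  - by rewrite smap_src sa -flip_cone flipK.
  - by rewrite smap_tgt ta flipK.
  - rewrite -[b]flipK -[X in homotopic X _]flipK flip_nat unflipK.
    exact: smap_homotopic.
rewrite -[a]flipK -[a']flipK; apply: smap_homotopic; apply: uniq.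
- by rewrite smap_src sa flip_cone.
- by rewrite smap_tgt ta.
- by rewrite smap_src sa' flip_cone.
- by rewrite smap_tgt ta'.
- by rewrite -!flip_nat; apply: smap_homotopic.
Qed.

End ProductRestriction.

Theorem proposition5p3p6 (K : cosmos) (cc : cartesian_closed K) (A B C : K)
    (k : hom A B 0) (f : hom B C 0) :
  initial k ->
  (forall (l : hom (pt K) C 0) (nu : hom B C 1),
     is_limit cc f l nu -> is_limit cc (f ∘ k) l (nu <* k)) /\
  (forall (l : hom (pt K) C 0) (nu : hom A C 1),
     is_limit cc (f ∘ k) l nu -> exists nu' : hom B C 1, is_limit cc f l nu').
Proof.
move=> ik.
have Xk1 (X : K) : pr1 X B ∘ prod_map (idm X) k = pr1 X A.
  by rewrite pr1_pair scomp_id0l.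
have Xk2 (X : K) : pr2 X B ∘ prod_map (idm X) k = k ∘ pr2 X A.
  by rewrite pr2_pair.
pose R X (x : hom (xprod X B) C 1) := x <* prod_map (idm X) k.
have Rcone (X : K) (zeta : hom X C 1) (nu : hom B C 1) chi :
    composes (zeta <* pr1 X B) (nu <* pr2 X B) chi ->
    composes (zeta <* pr1 X A) (nu <* k <* pr2 X A) (R X chi).
  move=> /(smap_composes (prec C (prod_map (idm X) k))).
  by rewrite /= !prec_comp Xk1 Xk2.
have qcat_hom (X Y : K) : is_qcat (hom X Y) by exact: hom_qcat.
(* A factorisation can be tested after restriction: both sides are cones over
   [f], so uniqueness in [product_restriction] applies. *)
have Rlift (X : K) (q : hom X C 0) l (zeta : hom X C 1) (nu : hom B C 1) chi :
    src nu = l ∘ to_pt B -> tgt nu = f ->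
    src zeta = q -> tgt zeta = l ∘ to_pt X ->
    src chi = q ∘ pr1 X B -> tgt chi = f ∘ pr2 X B ->
    composes (zeta <* pr1 X A) (nu <* k <* pr2 X A) (R X chi) ->
    composes (zeta <* pr1 X B) (nu <* pr2 X B) chi.
  move=> sn tn sz tz sc tc c.
  have [chi' c'] : exists chi', composes (zeta <* pr1 X B) (nu <* pr2 X B) chi'.
    apply: composes_ex => //; rewrite prec_src prec_tgt sn tz -!scompA.
    by rewrite (to_pt_eq (to_pt X ∘ _) (to_pt B ∘ pr2 X B)).
  apply/(composes_homotopic _ _ c') => //.
  have [_ uniq] := product_restriction cc ik q f.
  apply: uniq => //.
  - by rewrite (composes_src c') prec_src sz.
  - by rewrite (composes_tgt c') prec_tgt tn.
  - by apply/(composes_homotopic _ _ (Rcone _ _ _ _ c')).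
split=> l nu /is_limitE[sn tn H].
  apply/is_limitE; split; rewrite ?prec_src ?prec_tgt ?sn ?tn //.
    by rewrite -scompA (to_pt_eq (to_pt B ∘ k) (to_pt A)).
  move=> X q chi sc tc.
  have [ex _] := product_restriction cc ik q f.
  have [chi' [sc' tc' h]] := ex chi sc tc.
  have [zeta [[sz tz c] uniq]] := H X q chi' sc' tc'.
  exists zeta; split.
    split=> //; apply/(composes_homotopic _ _ (Rcone _ _ _ _ c)) => //.
  move=> z [sz' tz' cz']; apply: uniq; split=> //.
  apply: (Rlift X q l) => //; apply/(composes_homotopic _ _ cz') => //.
  exact: homotopic_sym.
have [ex _] := initial_restriction ik l f.
have [nu' [sn' tn' hn]] := ex nu sn tn; exists nu'.
apply/is_limitE; split=> // X q chi sc tc.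
have cone_nu zeta chi' : composes (zeta <* pr1 X A) (nu <* pr2 X A) chi' <->
    composes (zeta <* pr1 X A) (nu' <* k <* pr2 X A) chi'.
  have hn2 := smap_homotopic (prec C (pr2 X A)) hn.
  by split; apply: composes_congr => //; try exact: homotopic_refl;
    first exact: homotopic_sym.
have [||zeta [[sz tz c] uniq]] := H X q (R X chi).
- by rewrite prec_src sc -scompA Xk1.
- by rewrite prec_tgt tc -!scompA Xk2.
exists zeta; split.
  by split=> //; apply: (Rlift X q l) => //; apply/cone_nu.
move=> z [sz' tz' cz']; apply: uniq; split=> //; apply/cone_nu.
exact: Rcone.
Qed.
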